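(* Let $\mathcal{T}=(S,s_{\mathit{init}},\to,L)$ be a finite transition system, $E$ a set of terminal states, and $C$ a set of states disjoint from $E$. Let $\Phi=\Diamond E$ or $\Phi=\Box\neg E$, and let $\pi=s_0\dots s_n$ be a finite maximal path visiting $C$ and satisfying $\Phi$. Then it is decidable in polynomial time whether $C$ is a $d_{\mathit{Lev}}$-counterfactual cause for $\Phi$ on $\pi$.
   Context: A transition system is $\mathcal{T}=(S,s_{\mathit{init}},\to,L)$ with finite states $S$, initial state $s_{\mathit{init}}$, transitions $\to\subseteq S\times S$, labeling $L\colon S\to\Sigma=2^{\mathsf{AP}}$. Paths start in $s_{\mathit{init}}$ and follow transitions; traces are sequences of labels; terminal states have no outgoing transitions; maximal paths are infinite or end in a terminal state. For a distance function $d$ on maximal paths, $C$ is a $d$-counterfactual cause for $\Phi$ on $\pi$ (where $\pi$ visits $C$ and satisfies $\Phi$) if (1) some maximal path avoids $C$, and (2) every maximal path $\rho\models\Box\neg C$ with minimal $d(\pi,\rho)$ among maximal paths avoiding $C$ satisfies $\neg\Phi$. Levenshtein distance: with edit alphabet $\Gamma=(\Sigma\cup\{\varepsilon\})^2\setminus\{(\varepsilon,\varepsilon)\}$, an edit sequence for finite or infinite words $v,w$ is a finite or infinite word $\gamma$ over $\Gamma$ whose projection to the first (resp. second) component with $\varepsilon$'s removed is $v$ (resp. $w$); its weight is the number of positions $i$ with $\gamma_i\ne(\sigma,\sigma)$ for all $\sigma\in\Sigma$; $d_{\mathit{Lev}}(v,w)$ is the minimal weight of an edit sequence for $v$ and $w$,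 and on paths $d_{\mathit{Lev}}(\pi,\rho)=d_{\mathit{Lev}}(L(\pi),L(\rho))$. *)

(* Defs.v *)
From HB Require Import structures.
From mathcomp Require Import all_boot all_order all_algebra finmap.
From mathcomp Require Import mathcomp_extra boolp classical_sets functions.
From mathcomp Require Import cardinality constructive_ereal.

Set Implicit Arguments.
Unset Strict Implicit.
Unset Printing Implicit Defensive.

Import Order.TTheory GRing.Theory.

Local Open Scope ring_scope.

Variant word (A : Type) : Type :=
| Fin of seq A
| Inf of nat -> A.

(* [None] exactly when the position [i] is past the end of [u]. *)
Definition letter (A : Type) (u : word A) (i : nat) : option A :=
  match u with
  | Fin s => onth s i
  | Inf f => Some (f i)
  end.

Definition wmap (A B : Type) (f : A -> B) (u : word A) : word B :=
  match u with
  | Fin s => Fin (map f s)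
  | Inf g => Inf (f \o g)
  end.

Section Levenshtein.
Variable A : Type.

(* In a word over [option A] the letter [None] plays the role of epsilon. *)
Definition nonempty_at (u : word (option A)) (i : nat) : bool :=
  if letter u i is Some (Some _) then true else false.

(* [v] is [u] with all epsilons removed: the letter of [v] at position [k] is
   the non-epsilon letter of [u] preceded by exactly [k] others.  This
   determines the length of [v] too; in particular an infinite [u] with
   finitely many non-epsilon letters erases to a finite word. *)
Definition erases_to (u : word (option A)) (v : word A) : Prop :=
  forall k a, letter v k = Some a <->
    exists i, letter u i = Some (Some a) /\
              count (nonempty_at u) (iota 0 i) = k.

Definition edit_sequence (v w : word A) (g : word (option A * option A)) :
    Prop :=
  [/\ forall i, letter g i <> Some (None, None),
      erases_to (wmap fst g) v &
      erases_to (wmap snd g) w].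

Definition edit_positions (g : word (option A * option A)) : set nat :=
  [set i | exists e, letter g i = Some e /\
                     forall a : A, e <> (Some a, Some a)]%classic.

(* Weights and distances live in N u {+oo}, seen inside [\bar int] because the
   latter comes with its order in the library. *)
Definition weight (g : word (option A * option A)) : \bar int :=
  if `[< finite_set (edit_positions g) >]
  then (#|` fset_set (edit_positions g)|%fset%:R)%:E
  else +oo%E.

Definition edit_weights (v w : word A) : set (\bar int) :=
  [set weight g | g in edit_sequence v w]%classic.

(* The least element of [edit_weights v w]; it always exists, so that the
   default value [+oo] of [xget] is irrelevant. *)
Definition dLev (v w : word A) : \bar int :=
  xget +oo%E (edit_weights v w `&` lbound (edit_weights v w))%classic.

End Levenshtein.

Record transition_system (AP S : finType) := TransitionSystem {
  init : S;
  trans : rel S;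
  label : S -> {set AP}
}.

Section Paths.
Variables (AP S : finType) (T : transition_system AP S).

Definition terminal : {set S} := [set s | [forall t, ~~ trans T s t]].

Definition is_path (r : word S) : Prop :=
  letter r 0 = Some (init T) /\
  forall i s t, letter r i = Some s -> letter r i.+1 = Some t -> trans T s t.

Definition maximal_path (r : word S) : Prop :=
  is_path r /\
  forall i s, letter r i = Some s -> letter r i.+1 = None -> s \in terminal.

Definition trace (r : word S) : word {set AP} := wmap (label T) r.

Definition dLev_path (r1 r2 : word S) : \bar int := dLev (trace r1) (trace r2).

End Paths.

Section Properties.
Variable S : finType.

Definition eventually (A : {set S}) (r : word S) : Prop :=
  exists i s, letter r i = Some s /\ s \in A.

Definition always (A : {set S}) (r : word S) : Prop :=
  forall i s, letter r i = Some s -> s \in A.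

End Properties.

(* The conditions only; that [pi] is a maximal path which visits [C] and
   satisfies [Phi] is a proviso of the notion. *)
Definition counterfactual_cause (AP S : finType) (T : transition_system AP S)
    (disp : Order.disp_t) (D : porderType disp) (d : word S -> word S -> D)
    (C : {set S}) (Phi : word S -> Prop) (pi : word S) : Prop :=
  (exists r, maximal_path T r /\ always (~: C) r) /\
  (forall r, maximal_path T r -> always (~: C) r ->
     (forall r', maximal_path T r' -> always (~: C) r' ->
        (d pi r <= d pi r')%O) ->
     ~ Phi r).

(* [Reach] is <>E and [Avoid] is []~E. *)
Variant kind := Reach | Avoid.

Definition satisfies (S : finType) (k : kind) (E : {set S}) :
    word S -> Prop :=
  match k with
  | Reach => eventually E
  | Avoid => always (~: E)
  end.

(* Random access machines with finitely many registers in use, an infinite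
   memory addressed indirectly, addition and truncated subtraction, and unit
   cost per instruction.  Without multiplication the numbers produced in [t]
   steps have O(t + log n) bits on inputs of length n, so that such machines and
   Turing machines simulate each other with polynomial overhead
   (Cook and Reckhow, Time bounded random access machines, JCSS 1973). *)
Variant instr :=
| IConst (r k : nat)
| IAdd (r a b : nat)
| ISub (r a b : nat)
| ILoad (r a : nat)
| IStore (a r : nat)
| IJz (r l : nat)
| IHalt (b : bool).

Definition ram := seq instr.

Record config := Config { cpc : nat; creg : nat -> nat; cmem : nat -> nat }.

Definition set_reg (c : config) (r v : nat) : config :=
  Config (cpc c).+1 [eta creg c with r |-> v] (cmem c).

(* [inl b]: halt with verdict [b].  Falling off the program rejects. *)
Definition step (P : ram) (c : config) : bool + config :=
  let R := creg c in
  match nth (IHalt false) P (cpc c) with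
  | IConst r k => inr (set_reg c r k)
  | IAdd r a b => inr (set_reg c r (R a + R b)%N)
  | ISub r a b => inr (set_reg c r (R a - R b)%N)
  | ILoad r a => inr (set_reg c r (cmem c (R a)))
  | IStore a r => inr (Config (cpc c).+1 R [eta cmem c with R a |-> R r])
  | IJz r l => inr (Config (if R r == 0%N then l else (cpc c).+1) R (cmem c))
  | IHalt b => inl b
  end.

Fixpoint run (P : ram) (t : nat) (c : config) : option bool :=
  if t is t'.+1 then
    match step P c with
    | inl b => Some b
    | inr c' => run P t' c'
    end
  else None.

Definition start (x : seq bool) : config :=
  Config 0 [eta (fun=> 0%N) with 0%N |-> size x] (fun i => nth false x i).

Definition decides_within (P : ram) (q : {poly nat}) (x : seq bool)
    (Q : Prop) : Prop :=
  exists b : bool, run P q.[size x] (start x) = Some b /\ (b <-> Q).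

(* Unary notation; an index of a state in unary is no longer than the rows of
   the transition matrix. *)
Definition encode_nat (n : nat) : seq bool := rcons (nseq n true) false.

(* States are represented by their rank in [enum S]; transitions and labels
   are given by Boolean matrices in row-major order. *)
Definition encode_instance (AP S : finType) (T : transition_system AP S)
    (E C : {set S}) (k : kind) (pi : seq S) : seq bool :=
  let state (s : S) := encode_nat (enum_rank s) in
  let subset (A : {set S}) := [seq s \in A | s <- enum S] in
  [:: if k is Reach then true else false]
    ++ encode_nat #|S| ++ encode_nat #|AP| ++ encode_nat (size pi)
    ++ state (init T)
    ++ [seq trans T s t | s <- enum S, t <- enum S]
    ++ [seq a \in label T s | s <- enum S, a <- enum AP]
    ++ subset E ++ subset C
    ++ flatten [seq state s | s <- pi].

(* Main.v *)
(* Infinite paths are at distance [+oo] from the finite path [pi], and removing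
   loops from a finite path shows that the least finite distance is at most
   [size pi + #|S|], if there is one.  So the matter is to compare the least
   distances to the finite maximal [C]-avoiding paths that satisfy [Phi] and to
   those that do not, plus, when there are no such paths, the existence of an
   infinite [C]-avoiding path, that is, by the pigeonhole principle, of a
   [C]-avoiding path of [#|S| + 1] states.

   All of this is read off the table of the triples [(w, i, s)] such that some
   [C]-avoiding path from the initial state to [s] can be obtained from the
   first [i] letters of the trace of [pi] with weight exactly [w]: the last
   letter of an edit sequence expresses a triple by lexicographically smaller
   ones, and for [i = 0] the triples describe the lengths of paths.

   The table is filled by a program in which every loop and every sum ranges
   over the numbers below the input length, so that its running time is bounded
   by a polynomial computed from its text alone. *)
Require Import Defs.
From HB Require Import structures.
From mathcomp Require Import all_boot all_order all_algebra finmap.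
From mathcomp Require Import boolp classical_sets cardinality constructive_ereal.
From mathcomp Require Import zify.

Set Implicit Arguments.
Unset Strict Implicit.
Unset Printing Implicit Defensive.

(** * A loop language for the machines *)

(** [ESum] iterates over the numbers below the input length only, which keeps evaluation polynomial.
    A nonzero value counts as true: [EGuard] then acts as a conjunction that still returns the value
    of its second argument. *)
Inductive exp :=
| EVar of nat
| ECst of nat
| ELen
| EAdd of exp & exp
| ESub of exp & exp
| EGet of exp
| EGuard of exp & exp
| ESum of nat & exp.

Inductive cmd :=
| CPut of exp & exp
| CFor of nat & cmd.

Definition upd (f : nat -> nat) (x v : nat) : nat -> nat :=
  fun y => if y == x then v else f y.

Fixpoint eval (n : nat) (V M : nat -> nat) (e : exp) : nat :=
  match e with
  | EVar x => V x
  | ECst k => k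
  | ELen => n
  | EAdd e1 e2 => eval n V M e1 + eval n V M e2
  | ESub e1 e2 => eval n V M e1 - eval n V M e2
  | EGet e1 => M (eval n V M e1)
  | EGuard e1 e2 => if eval n V M e1 == 0 then 0 else eval n V M e2
  | ESum x e1 => \sum_(i < n) eval n (upd V x i) M e1
  end.

Fixpoint exec (n : nat) (V M : nat -> nat) (c : cmd) : nat -> nat :=
  match c with
  | CPut a e => upd M (eval n V M a) (eval n V M e)
  | CFor x c1 => foldl (fun M' i => exec n (upd V x i) M' c1) M (iota 0 n)
  end.

(* Register 0 keeps the input length, odd registers hold the variables and the
   other even ones the temporaries. *)
Definition vreg (x : nat) := x.*2.+1.
Definition treg (d : nat) := d.*2.+2.

Arguments vreg : simpl never.
Arguments treg : simpl never.

(* [x] is saved in temporary [d] and restored at the end, so that loops, and hence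
   expressions, leave the variables unchanged. *)
Definition compile_loop (x d : nat) (body : nat -> seq instr) (pc : nat) :
    seq instr :=
  let b := body (pc + 5) in
  [:: IConst (treg d) 0; IAdd (treg d) (treg d) (vreg x); IConst (vreg x) 0;
      ISub (treg d.+1) 0 (vreg x); IJz (treg d.+1) (pc + 5 + size b + 4)]
  ++ b ++
  [:: IConst (treg d.+1) 1; IAdd (vreg x) (vreg x) (treg d.+1);
      IConst (treg d.+1) 0; IJz (treg d.+1) (pc + 3);
      IConst (vreg x) 0; IAdd (vreg x) (vreg x) (treg d)].

Arguments compile_loop : simpl never.

(* The value of [e] goes to temporary [d]; the temporaries below [d] are kept. *)
Fixpoint compile_exp (e : exp) (d pc : nat) : seq instr :=
  match e with
  | EVar x => [:: IConst (treg d) 0; IAdd (treg d) (treg d) (vreg x)]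
  | ECst k => [:: IConst (treg d) k]
  | ELen => [:: IConst (treg d) 0; IAdd (treg d) (treg d) 0]
  | EAdd e1 e2 =>
      let p1 := compile_exp e1 d pc in
      let p2 := compile_exp e2 d.+1 (pc + size p1) in
      p1 ++ p2 ++ [:: IAdd (treg d) (treg d) (treg d.+1)]
  | ESub e1 e2 =>
      let p1 := compile_exp e1 d pc in
      let p2 := compile_exp e2 d.+1 (pc + size p1) in
      p1 ++ p2 ++ [:: ISub (treg d) (treg d) (treg d.+1)]
  | EGet e1 => compile_exp e1 d pc ++ [:: ILoad (treg d) (treg d)]
  | EGuard e1 e2 =>
      let p1 := compile_exp e1 d pc in
      let p2 := compile_exp e2 d (pc + size p1).+1 in
      p1 ++ [:: IJz (treg d) ((pc + size p1).+1 + size p2)] ++ p2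
  | ESum x e1 =>
      IConst (treg d) 0 ::
      compile_loop x d.+1 (fun pc' => compile_exp e1 d.+2 pc' ++
        [:: IAdd (treg d) (treg d) (treg d.+2)]) pc.+1
  end.

Fixpoint compile_cmd (c : cmd) (d pc : nat) : seq instr :=
  match c with
  | CPut a e =>
      let p1 := compile_exp a d pc in
      let p2 := compile_exp e d.+1 (pc + size p1) in
      p1 ++ p2 ++ [:: IStore (treg d) (treg d.+1)]
  | CFor x c1 => compile_loop x d (compile_cmd c1 d.+1) pc
  end.

Definition compile (c : cmd) (e : exp) : ram :=
  let p1 := compile_cmd c 0 0 in
  let p2 := compile_exp e 0 (size p1) in
  p1 ++ p2 ++ [:: IJz (treg 0) (size p1 + size p2 + 2); IHalt true; IHalt false].

(** * Running time of compiled programs *)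

Section Cost.
Local Open Scope ring_scope.
Import GRing.Theory.

(** Each round costs 2 instructions for the test and 4 for the increment and the jump back. Outside
    the rounds there are 3 to save and reset the variable, 2 for the last test and 2 to restore
    it. *)
Definition loop_cost (p : {poly nat}) : {poly nat} := (p + 6%N%:P) * 'X + 7%N%:P.

Fixpoint exp_cost (e : exp) : {poly nat} :=
  match e with
  | EVar _ | ELen => 2%N%:P
  | ECst _ => 1%N%:P
  | EAdd e1 e2 | ESub e1 e2 | EGuard e1 e2 => exp_cost e1 + exp_cost e2 + 1%N%:P
  | EGet e1 => exp_cost e1 + 1%N%:P
  | ESum _ e1 => loop_cost (exp_cost e1 + 1%N%:P) + 1%N%:P
  end.

Fixpoint cmd_cost (c : cmd) : {poly nat} :=
  match c with
  | CPut a e => exp_cost a + exp_cost e + 1%N%:P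
  | CFor _ c1 => loop_cost (cmd_cost c1)
  end.

Definition compile_cost (c : cmd) (e : exp) : {poly nat} :=
  cmd_cost c + exp_cost e + 2%N%:P.

Lemma horner_natD (p q : {poly nat}) n : (p + q).[n] = (p.[n] + q.[n])%N.
Proof. exact: hornerD. Qed.

Lemma horner_loop_cost (p : {poly nat}) n :
  (loop_cost p).[n] = (n * (p.[n] + 6) + 7)%N.
Proof.
by rewrite /loop_cost horner_natD hornerMX horner_natD !hornerC [RHS]addnC
  [RHS]addnC mulnC.
Qed.

Definition costE := (horner_natD, horner_loop_cost, @hornerC nat).

End Cost.

(** * Correctness of the compiler *)

Definition reach (P : ram) (t : nat) (c c' : config) : Prop :=
  forall t', run P (t + t') c = run P t' c'.

(** Since [reach] quantifies over the remaining fuel, segments of a run compose whatever happens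
    afterwards. *)
Lemma reach_trans P t1 t2 c1 c2 c3 :
  reach P t1 c1 c2 -> reach P t2 c2 c3 -> reach P (t1 + t2) c1 c3.
Proof. by move=> h1 h2 t; rewrite -addnA h1 h2. Qed.

Lemma reach1 P c c' : step P c = inr c' -> reach P 1 c c'.
Proof. by move=> h t /=; rewrite h. Qed.

Definition code_at (P : ram) (pc : nat) (code : seq instr) : Prop :=
  exists P1 P2, P = P1 ++ code ++ P2 /\ size P1 = pc.

Lemma code_at_cat P pc s1 s2 :
  code_at P pc (s1 ++ s2) -> code_at P pc s1 /\ code_at P (pc + size s1) s2.
Proof.
move=> [P1 [P2 [-> <-]]]; split.
  by exists P1, (s2 ++ P2); rewrite -!catA.
by exists (P1 ++ s1), P2; rewrite -!catA size_cat.
Qed.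

Lemma code_at_cons P pc i s :
  code_at P pc (i :: s) ->
  nth (IHalt false) P pc = i /\ code_at P pc.+1 s.
Proof.
move=> [P1 [P2 [-> <-]]]; split; first by rewrite nth_cat ltnn subnn.
by exists (rcons P1 i), P2; rewrite -cats1 -!catA size_cat addn1.
Qed.

Section Simulation.
Variables (P : ram) (n : nat).

(* [T] lists the values of the temporaries below [d]. *)
Record sim (d : nat) (V M T : nat -> nat) (c : config) : Prop := Sim {
  sim_len : creg c 0 = n;
  sim_var : forall x, creg c (vreg x) = V x;
  sim_mem : forall a, cmem c a = M a;
  sim_tmp : forall k, k < d -> creg c (treg k) = T k
}.

(** A Hoare triple with a time bound and with explicit entry and exit addresses. *)
Definition runs (t pc pc' : nat) (A B : config -> Prop) : Prop :=
  forall c, cpc c = pc -> A c ->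
    exists t' c', [/\ t' <= t, reach P t' c c', cpc c' = pc' & B c'].

Lemma runs_seq t1 t2 pc1 pc2 pc3 A B C :
  runs t1 pc1 pc2 A B -> runs t2 pc2 pc3 B C ->
  runs (t1 + t2) pc1 pc3 A C.
Proof.
move=> h1 h2 c pcc Ac; have [s1 [c1 [l1 r1 p1 B1]]] := h1 _ pcc Ac.
have [s2 [c2 [l2 r2 p2 C2]]] := h2 _ p1 B1.
by exists (s1 + s2), c2; split=> //; [exact: leq_add | exact: reach_trans r1 r2].
Qed.

Lemma runs_weak t t' pc pc' (A A' B B' : config -> Prop) :
  runs t pc pc' A B -> t <= t' -> (forall c, A' c -> A c) ->
  (forall c, B c -> B' c) -> runs t' pc pc' A' B'.
Proof.
move=> h lt hA hB c pcc /hA Ac; have [s [c' [l r p Bc]]] := h _ pcc Ac.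
by exists s, c'; split=> //; [exact: leq_trans l lt | exact: hB].
Qed.

Lemma runs1 pc pc' (A B : config -> Prop) :
  (forall c, cpc c = pc -> A c ->
    exists2 c', step P c = inr c' & cpc c' = pc' /\ B c') ->
  runs 1 pc pc' A B.
Proof.
move=> h c pcc Ac; have [c' st [pc'c Bc]] := h _ pcc Ac.
by exists 1, c'; split=> //; exact: reach1.
Qed.

Lemma treg_vreg d x : (treg d == vreg x) = false.
Proof. by rewrite /treg /vreg; lia. Qed.

Lemma vreg_treg d x : (vreg x == treg d) = false.
Proof. by rewrite /treg /vreg; lia. Qed.

Lemma eq_treg d d' : (treg d == treg d') = (d == d').
Proof. by rewrite /treg; lia. Qed.

Lemma eq_vreg d d' : (vreg d == vreg d') = (d == d').
Proof. by rewrite /vreg; lia. Qed.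

Lemma treg0 d : (treg d == 0) = false. Proof. by []. Qed.
Lemma vreg0 d : (vreg d == 0) = false. Proof. by []. Qed.
Lemma zero_treg d : (0 == treg d) = false. Proof. by []. Qed.
Lemma zero_vreg d : (0 == vreg d) = false. Proof. by []. Qed.

Definition regE :=
  (treg_vreg, vreg_treg, eq_treg, eq_vreg, treg0, vreg0, zero_treg, zero_vreg).

Lemma set_reg_var d V M T c x v :
  sim d V M T c -> sim d (upd V x v) M T (set_reg c (vreg x) v).
Proof.
case=> h0 hv hm ht; split=> //= [y|k]; rewrite ?regE //; last exact: ht.
by rewrite /upd hv.
Qed.

Lemma sim_weak d d' V V' M T T' c :
  sim d V M T c -> d' <= d -> V =1 V' -> (forall k, k < d' -> T k = T' k) ->
  sim d' V' M T' c.
Proof.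
case=> h0 hv hm ht dd hV hT; split=> // [x|k kd]; first by rewrite hv hV.
by rewrite ht ?hT //; exact: leq_trans kd dd.
Qed.

(** Memory and temporaries are indexed by the round so that one statement serves both loops: [CFor]
    changes the memory and keeps the temporaries, [ESum] keeps the memory and accumulates in a
    temporary. The condition on [T] says that temporary [d] holds the saved value of [x]. *)
Lemma runs_loop x d body pc V (M T : nat -> nat -> nat) t :
  code_at P pc (compile_loop x d body pc) ->
  (forall i, T i d = V x) ->
  (forall i, i < n ->
     code_at P (pc + 5) (body (pc + 5)) ->
     runs t (pc + 5) (pc + 5 + size (body (pc + 5)))
       (sim d.+1 (upd V x i) (M i) (T i))
       (sim d.+1 (upd V x i) (M i.+1) (T i.+1))) ->
  runs (n * (t + 6) + 7) pc (pc + size (compile_loop x d body pc))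
    (sim d V (M 0) (T 0)) (sim d V (M n) (T n)).
Proof.
rewrite /compile_loop; set b := body (pc + 5); set L1 := [:: _; _; _; _; _].
move=> /code_at_cat[h1 /code_at_cat[hb h2]] hT hbody.
move: (h1) (h2); rewrite /L1 => h1' h2'.
have -> : pc + size (L1 ++ b ++ [:: IConst (treg d.+1) 1;
   IAdd (vreg x) (vreg x) (treg d.+1); IConst (treg d.+1) 0;
   IJz (treg d.+1) (pc + 3); IConst (vreg x) 0; IAdd (vreg x) (vreg x) (treg d)])
   = (pc + 5 + size b + 6) by rewrite !size_cat /=; lia.
have [i0 {}h1'] := code_at_cons h1'.
have [i1 {}h1'] := code_at_cons h1'.
have [i2 {}h1'] := code_at_cons h1'.
have [i3 {}h1'] := code_at_cons h1'.
have [i4 {h1'}_] := code_at_cons h1'.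
have [j0 {}h2'] := code_at_cons h2'.
have [j1 {}h2'] := code_at_cons h2'.
have [j2 {}h2'] := code_at_cons h2'.
have [j3 {}h2'] := code_at_cons h2'.
have [j4 {}h2'] := code_at_cons h2'.
have [j5 {h2'}_] := code_at_cons h2'.
rewrite /= in j0 j1 j2 j3 j4 j5.
have hinit : runs 3 pc (pc + 3) (sim d V (M 0) (T 0))
    (sim d.+1 (upd V x 0) (M 0) (T 0)).
  move=> c pcc hs; exists 3; eexists; split=> //.
  - move=> t'; rewrite /= /step pcc i0 /= pcc i1 /= pcc i2 /=; reflexivity.
  - by rewrite /= pcc addn3.
  - apply: set_reg_var; rewrite /= ?regE eqxx.
    split => /=.
    + by rewrite (sim_len hs).
    + by move=> y; rewrite ?regE (sim_var hs).
    + exact: (sim_mem hs).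
    + move=> k; rewrite regE ltnS leq_eqVlt; case: eqP => [->|_] /=.
        by move=> _; rewrite (sim_var hs) hT.
      exact: (sim_tmp hs).
have hexit : runs 4 (pc + 3) (pc + 5 + size b + 6)
    (sim d.+1 (upd V x n) (M n) (T n)) (sim d V (M n) (T n)).
  move=> c pcc hs; exists 4; eexists; split=> //.
  - move=> t'; rewrite /= /step pcc addn3 i3 /= pcc addn3 i4 /=.
    rewrite ?regE eqxx (sim_len hs) (sim_var hs) /upd eqxx subnn eqxx.
    (* The exit jump skips the four instructions for the increment and the jump back, and lands on
       the two that restore [x]. *)
    have -> : pc + 5 + size b + 4 = (pc + 5 + size b).+4 by lia.
    rewrite /= j4 /= j5 /=; reflexivity.
  - by rewrite /=; lia.
  - split => /=.
    + by rewrite ?regE (sim_len hs).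
    + move=> y; rewrite ?regE; case: eqP => [->|/eqP yx] /=.
        by rewrite !eqxx  ?regE (negbTE (_ : d != d.+1)) ?(sim_tmp hs) ?hT //; lia.
      by rewrite (sim_var hs) /upd (negbTE yx).
    + exact: (sim_mem hs).
    + move=> k kd; rewrite ?regE (_ : (k == d.+1) = false); last lia.
      by rewrite (sim_tmp hs) //; lia.
have hiter i : i < n -> runs (t + 6) (pc + 3) (pc + 3)
    (sim d.+1 (upd V x i) (M i) (T i))
    (sim d.+1 (upd V x i.+1) (M i.+1) (T i.+1)).
  move=> ltin.
  have -> : t + 6 = 2 + (t + 4) by lia.
  apply: (@runs_seq _ _ _ (pc + 5) _ _ (sim d.+1 (upd V x i) (M i) (T i))).
    move=> c pcc hs; exists 2; eexists; split=> //.
    - move=> t'; rewrite /= /step pcc addn3 i3 /= pcc addn3 i4 /=.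
      rewrite ?regE eqxx (sim_len hs) (sim_var hs) /upd eqxx.
      rewrite (_ : (n - i == 0) = false); last lia.
      reflexivity.
    - by rewrite /=; lia.
    - split => /=.
      + exact: (sim_len hs).
      + by move=> y; rewrite regE (sim_var hs).
      + exact: (sim_mem hs).
      + move=> k kd; rewrite regE (_ : (k == d.+1) = false) ?(sim_tmp hs) //.
        by lia.
  apply: runs_seq (hbody _ ltin hb) _.
  rewrite -/b => c pcc hs; exists 4; eexists; split=> //.
  - move=> t'; rewrite /= /step pcc j0 /= pcc j1 /= pcc j2 /= pcc j3 /=.
    rewrite ?regE ?eqxx /=; reflexivity.
  - by [].
  - split => /=.
    + by rewrite ?regE (sim_len hs).
    + move=> y; rewrite ?regE ?eqxx /upd /=; case: eqP => [_|/eqP yx].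
        by rewrite (sim_var hs) /upd eqxx addn1.
      by rewrite (sim_var hs) /upd (negbTE yx).
    + exact: (sim_mem hs).
    + move=> k kd; rewrite ?regE (_ : (k == d.+1) = false); last lia.
      by rewrite (sim_tmp hs).
(* Induction on the number [k] of rounds left. *)
have hloop k i : i + k = n -> runs (k * (t + 6) + 4) (pc + 3) (pc + 5 + size b + 6)
    (sim d.+1 (upd V x i) (M i) (T i)) (sim d V (M n) (T n)).
  elim: k i => [|k IHk] i ik; first by move: hexit; rewrite -ik addn0.
  rewrite mulSn -addnA; apply: runs_seq (IHk i.+1 _); last lia.
  by apply: hiter; lia.
rewrite (_ : _ + 7 = 3 + (n * (t + 6) + 4)); last lia.
by apply: runs_seq hinit (hloop n 0 _).
Qed.

(** Covers the instructions that write a temporary. The depths before and after differ because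
    operands above the result are discarded, while a constant opens a new temporary. *)
Lemma runs_op d' d e V M T T' pc (i : instr) f :
  nth (IHalt false) P pc = i ->
  (forall c, sim d' V M T c -> cpc c = pc ->
     step P c = inr (set_reg c (treg e) (f c))) ->
  (forall c, sim d' V M T c -> f c = T' e) ->
  (forall k, k < d -> k != e -> k < d' /\ T k = T' k) ->
  runs 1 pc (pc + 1) (sim d' V M T) (sim d V M T').
Proof.
move=> hi hst hf hT; apply: runs1 => c pcc hs.
exists (set_reg c (treg e) (f c)); first exact: hst.
split; first by rewrite /= pcc addn1.
split=> /= [|x|a|k kd]; first by rewrite ?regE (sim_len hs).
- by rewrite ?regE (sim_var hs).
- exact: (sim_mem hs).
rewrite ?regE; case: eqP => [-> |/eqP ke]; first exact: hf.
by have [kd' <-] := hT k kd ke; exact: (sim_tmp hs).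
Qed.

Lemma eq_upd T d v k : k < d -> T k = upd T d v k.
Proof. by rewrite /upd; case: eqP => // ->; rewrite ltnn. Qed.

Lemma upd_eq T d v : upd T d v d = v.
Proof. by rewrite /upd eqxx. Qed.

Lemma runs_exp e d pc V M T :
  code_at P pc (compile_exp e d pc) ->
  runs (exp_cost e).[n]%R pc (pc + size (compile_exp e d pc))
    (sim d V M T) (sim d.+1 V M (upd T d (eval n V M e))).
Proof.
(* There is no move instruction: a register is copied by adding it to a zeroed temporary, so the
   source must differ from the target. *)
have runs_copy r W T0 d0 pc0 v :
    (forall c, sim d0 W M T0 c -> creg c r = v) -> (r == treg d0) = false ->
    code_at P pc0 [:: IConst (treg d0) 0; IAdd (treg d0) (treg d0) r] ->
    runs 2 pc0 (pc0 + 2) (sim d0 W M T0) (sim d0.+1 W M (upd T0 d0 v)).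
  move=> hr rd /code_at_cons[i0 /code_at_cons[i1 _]] c pcc hs.
  exists 2; eexists; split=> //.
  - move=> t'; rewrite /= /step pcc i0 /= pcc i1 /= eqxx rd; reflexivity.
  - by rewrite /= pcc addn2.
  - rewrite -(hr _ hs); split => /= [|x|a|k].
    + by rewrite ?regE (sim_len hs).
    + by rewrite ?regE (sim_var hs).
    + exact: (sim_mem hs).
    + rewrite ?regE ltnS leq_eqVlt /upd; case: eqP => // _; exact: (sim_tmp hs).
elim: e d pc V T => [x|k||e1 IH1 e2 IH2|e1 IH1 e2 IH2|e1 IH1|e1 IH1 e2 IH2|x e1 IH1] d pc V T.
- by rewrite /= costE; apply: runs_copy; rewrite ?regE // => c /sim_var.
- rewrite /= costE => /code_at_cons[i0 _].
  apply: (runs_op i0 (f := fun=> k)) => [c hs pcc|c _|j].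
  + by rewrite /step pcc i0.
  + by rewrite upd_eq.
  + move=> kd kd'; have {kd kd'} kd : j < d by lia.
    by split; rewrite -?eq_upd.
- by rewrite /= costE; apply: runs_copy; rewrite ?regE // => c /sim_len.
- rewrite /= !costE => /code_at_cat[c1 /code_at_cat[c2 /code_at_cons[c3 _]]].
  rewrite !size_cat /= !addnA.
  apply: runs_seq (runs_seq (IH1 _ _ V T c1) (IH2 _ _ V _ c2)) _.
  apply: (runs_op (d' := d.+2) c3
    (f := fun c => creg c (treg d) + creg c (treg d.+1))) => // [c hs pcc|c hs|k kd kd'].
  + by rewrite /step pcc c3.
  + by rewrite !(sim_tmp hs) // /upd eqn_leq !ltnn !eqxx andbF.
  + by split; [|rewrite -!eq_upd //]; lia.
- rewrite /= !costE => /code_at_cat[c1 /code_at_cat[c2 /code_at_cons[c3 _]]].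
  rewrite !size_cat /= !addnA.
  apply: runs_seq (runs_seq (IH1 _ _ V T c1) (IH2 _ _ V _ c2)) _.
  apply: (runs_op (d' := d.+2) c3
    (f := fun c => creg c (treg d) - creg c (treg d.+1))) => // [c hs pcc|c hs|k kd kd'].
  + by rewrite /step pcc c3.
  + by rewrite !(sim_tmp hs) // /upd eqn_leq !ltnn !eqxx andbF.
  + by split; [|rewrite -!eq_upd //]; lia.
- rewrite /= !costE => /code_at_cat[c1 /code_at_cons[c3 _]].
  rewrite !size_cat /= !addnA.
  apply: runs_seq (IH1 _ _ V T c1) _.
  apply: (runs_op (d' := d.+1) c3
    (f := fun c => cmem c (creg c (treg d)))) => // [c hs pcc|c hs|k kd kd'].
  + by rewrite /step pcc c3.
  + by rewrite !(sim_tmp hs) // (sim_mem hs) /upd !eqxx.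
  + by split; [|rewrite -!eq_upd //]; lia.
- rewrite /= !costE => /code_at_cat[c1 /code_at_cons[c3 c2]].
  rewrite size_cat /=.
  have h1 := IH1 _ _ V T c1; have h2 := IH2 _ _ V T c2.
  move=> c pcc hs; have [t1 [c' [le1 r1 pc1 hs1]]] := h1 _ pcc hs.
  have htd : creg c' (treg d) = eval n V M e1 by rewrite (sim_tmp hs1) ?upd_eq.
  have hs1' : sim d V M T c'.
    by apply: sim_weak hs1 _ _ _ => // k kd; rewrite -eq_upd.
  (* When the guard is zero, temporary [d] already holds the result 0, so it suffices to jump over
     the code of [e2]. *)
  case: (eqVneq (eval n V M e1) 0) => [e0|e0].
    exists (t1 + 1), (Config ((pc + size (compile_exp e1 d pc)).+1 +
      size (compile_exp e2 d (pc + size (compile_exp e1 d pc)).+1)) (creg c') (cmem c')).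
    split.
    - by lia.
    - by apply: reach_trans r1 _; apply: reach1; rewrite /step pc1 c3 htd e0.
    - by rewrite /=; lia.
    - by move: hs1; rewrite e0 => -[? ? ? ?].
  have [|t2 [c'' [le2 r2 pc2 hs2]]] := h2
    (Config (pc + size (compile_exp e1 d pc)).+1 (creg c') (cmem c')) erefl.
    by case: hs1' => *.
  exists (t1 + 1 + t2), c''; split=> //; [by lia | | by lia].
  apply: reach_trans r2; apply: reach_trans r1 _; apply: reach1.
  by rewrite /step pc1 c3 htd (negbTE e0).
- rewrite /= !costE => /code_at_cons[c0]; set L := compile_loop _ _ _ _ => c1.
  rewrite -[pc + (size L).+1]addSnnS.
  have h0 : runs 1 pc pc.+1 (sim d V M T) (sim d.+1 V M (upd T d 0)).
    rewrite -[pc.+1]addn1; apply: (runs_op c0 (f := fun=> 0)) => [c hs pcc|c _|j].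
    + by rewrite /step pcc c0.
    + by rewrite upd_eq.
    + move=> kd kd'; have {kd kd'} kd : j < d by lia.
    by split; rewrite -?eq_upd.
  (* Temporary [d] holds the partial sum and [d.+1] the saved value of [x]. *)
  pose Ts i := upd (upd T d (\sum_(j < i) eval n (upd V x j) M e1)) d.+1 (V x).
  have h1 : runs (n * ((exp_cost e1).[n]%R + 1 + 6) + 7) pc.+1 (pc.+1 + size L)
      (sim d.+1 V M (Ts 0)) (sim d.+1 V M (Ts n)).
    apply: (runs_loop (M := fun=> M) (T := Ts)) c1 _ _.
      by move=> i; rewrite /Ts upd_eq.
    move=> i ltin /code_at_cat[h2 /code_at_cons[h3 _]].
    rewrite size_cat addnA.
    apply: runs_seq (IH1 _ _ _ _ h2) _.
    apply: (runs_op (d' := d.+3) h3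
      (f := fun c => creg c (treg d) + creg c (treg d.+2))) => // [c hs pcc|c hs|k kd kd'].
    + by rewrite /step pcc h3.
    + rewrite !(sim_tmp hs) //; last lia.
      have [d1 d2] : (d == d.+1) = false /\ (d == d.+2) = false by lia.
      by rewrite /Ts /upd !eqxx d1 d2 big_ord_recr.
    + split; first lia.
      rewrite -eq_upd // /Ts /upd; case: eqP => // _.
      by rewrite (negbTE kd').
  apply: runs_weak (runs_seq h0 (runs_weak h1 (leqnn _) _ (fun c hs => hs))) _ (fun c hs => hs) _.
  + move=> c hs; apply: sim_weak hs _ _ _ => // k kd.
    by rewrite /Ts big_ord0; exact: eq_upd.
  + by rewrite addnC.
  + by move=> c hs; apply: sim_weak hs _ _ _ => // k kd; rewrite /Ts -(@eq_upd _ d.+1).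
Qed.

Lemma runs_cmd c d pc V M T :
  code_at P pc (compile_cmd c d pc) ->
  runs (cmd_cost c).[n]%R pc (pc + size (compile_cmd c d pc))
    (sim d V M T) (sim d V (exec n V M c) T).
Proof.
elim: c d pc V M T => [a e|x c IH] d pc V M T /=.
  rewrite !costE => /code_at_cat[c1 /code_at_cat[c2 /code_at_cons[c3 _]]].
  rewrite !size_cat /= !addnA.
  apply: runs_seq (runs_seq (runs_exp c1) (runs_exp c2)) _.
  apply: runs1 => c pcc hs.
  exists (Config (cpc c).+1 (creg c) [eta cmem c with creg c (treg d) |-> creg c (treg d.+1)]).
    by rewrite /step pcc c3.
  split; first by rewrite /= pcc addn1.
  have hd : d == d.+1 = false by lia.
  split=> /= [|y|b|k kd]; first exact: (sim_len hs).
  + exact: (sim_var hs).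
  + by rewrite (sim_mem hs) !(sim_tmp hs) // /upd hd !eqxx.
  + by rewrite (sim_tmp hs) -?eq_upd //; lia.
rewrite costE => h.
pose Ms i := foldl (fun M' i => exec n (upd V x i) M' c) M (iota 0 i).
pose T' := upd T d (V x).
apply: runs_weak (runs_loop (M := Ms) (T := fun=> T') h _ _) (leqnn _) _ _.
- by move=> i; rewrite /T' upd_eq.
- move=> i ltin hc; have -> : Ms i.+1 = exec n (upd V x i) (Ms i) c.
    by rewrite /Ms -addn1 iotaD foldl_cat.
  exact: IH.
- by move=> b hs; apply: sim_weak hs _ _ _ => // k kd; rewrite /T' -eq_upd.
- by move=> b hs; apply: sim_weak hs _ _ _ => // k kd; rewrite /T' -eq_upd.
Qed.

End Simulation.

Lemma run_more P t t' c b : run P t c = Some b -> t <= t' -> run P t' c = Some b.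
Proof.
elim: t t' c => // t IH [//|t'] c /=; case: (step P c) => // c' h le.
exact: IH h le.
Qed.

Lemma compile_correct (c : cmd) (e : exp) (x : seq bool) :
  run (compile c e) (compile_cost c e).[size x]%R (start x) =
  Some (eval (size x) (fun=> 0)
          (exec (size x) (fun=> 0) (fun i => nth false x i) c) e != 0).
Proof.
set n := size x; set M : nat -> nat := fun i => nth false x i; set P := compile c e.
have: code_at P 0 P by exists [::], [::]; rewrite cats0.
rewrite {2}/P /compile => /code_at_cat[c1 /code_at_cat[c2 c3]].
have [i0 {}c3] := code_at_cons c3; have [i1 {}c3] := code_at_cons c3.
have [i2 _] := code_at_cons c3.
have hs : sim n 0 (fun=> 0) M (fun=> 0) (start x) by split.
have [t1 [k1 [le1 r1 pc1 hs1]]] := runs_cmd c1 (erefl : cpc (start x) = 0) hs.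
have [t2 [k2 [le2 r2 pc2 hs2]]] := runs_exp c2 pc1 hs1.
set v := eval _ _ _ e in hs2 *.
have hv : creg k2 (treg 0) = v by rewrite (sim_tmp hs2) ?upd_eq.
have hr : run P (t1 + (t2 + 2)) (start x) = Some (v != 0).
  rewrite r1 r2 /= /step pc2 i0 hv; case: (v == 0) => /=; last by rewrite i1.
  by move: i2; rewrite -addn2 => ->.
apply: run_more hr _; rewrite /compile_cost !costE -addnA.
by rewrite leq_add // leq_add2r.
Qed.

Lemma exec_for n (J : nat -> (nat -> nat) -> Prop) V x c M :
  (forall i M', i < n -> J i M' -> J i.+1 (exec n (upd V x i) M' c)) ->
  J 0 M -> J n (exec n V M (CFor x c)).
Proof.
move=> hJ J0 /=; suff h i : i <= n ->
    J i (foldl (fun M' i => exec n (upd V x i) M' c) M (iota 0 i)) by exact: h.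
elim: i => // i IH lt; have -> : iota 0 i.+1 = iota 0 i ++ [:: i] by rewrite -[i.+1]addn1 iotaD.
rewrite foldl_cat /=.
by apply: hJ => //; apply: IH; exact: ltnW.
Qed.

(** * Logical reading of expressions *)

(* Macros bind only variables from 10 on, so that an argument that mentions
   only variables below 10 is never captured. *)
Definition EEq e1 e2 := ESub (ECst 1) (EAdd (ESub e1 e2) (ESub e2 e1)).
Definition ENot e := ESub (ECst 1) e.
Definition EMul e1 e2 := ESum 10 (EGuard (ESub e1 (EVar 10)) e2).
(** In a concatenation of unary numerals, field [i] is the number of ones preceded by exactly [i]
    zeros. Variable 11 runs over the positions, and variable 12 counts the zeros before one. *)
Definition EField p i :=
  ESum 11 (EGuard (EGet (EAdd p (EVar 11)))
    (EEq (ESum 12 (EGuard (ESub (EVar 11) (EVar 12)) (ENot (EGet (EAdd p (EVar 12)))))) i)).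

Lemma sum_lt n k : k <= n -> \sum_(j < n) (j < k) = k.
Proof.
move=> kn; rewrite -big_mkcond /= -(big_ord_widen _ (fun=> 1)) // sum1_card.
by rewrite card_ord.
Qed.

(** * Decoding unary fields *)

Section Field.

Definition fields (ks : seq nat) : seq bool := flatten (map encode_nat ks).

Lemma size_encode_nat k : size (encode_nat k) = k.+1.
Proof. by rewrite size_rcons size_nseq. Qed.

Lemma nth_encode_nat k rest y : y <= k ->
  nth false (encode_nat k ++ rest) y = (y < k).
Proof.
move=> yk; rewrite nth_cat size_encode_nat ltnS yk nth_rcons size_nseq nth_nseq.
by case: ltnP => // ky; rewrite if_same.
Qed.

(** Induction on the fields: the first one contributes only to [i = 0], and its closing zero shifts
    the count for all later positions. Positions past the fields are preceded by at least [size ks]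
    zeros, more than [i], so they add nothing. *)
Lemma count_fields ks i n (b : nat -> bool) :
  (forall y, y < size (fields ks) -> b y = nth false (fields ks) y) ->
  size (fields ks) <= n -> i < size ks ->
  \sum_(y < n) (b y && (\sum_(z < y) ~~ b z == i)) = nth 0 ks i.
Proof.
elim: ks i n b => // k ks IH i n b hb.
rewrite /fields /= size_cat size_encode_nat => hn hi.
have b1 y : y < k -> b y.
  move=> yk; rewrite hb; last by rewrite /fields /= size_cat size_encode_nat; lia.
  by rewrite [fields _]/= nth_encode_nat // ltnW.
have b0 : b k = false.
  rewrite hb; last by rewrite /fields /= size_cat size_encode_nat; lia.
  by rewrite [fields _]/= nth_encode_nat // ltnn.
have c0 y : y <= k -> \sum_(z < y) ~~ b z = 0.
  move=> yk; rewrite big1 // => z _.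
  by rewrite b1 //; exact: leq_trans (ltn_ord z) yk.
have c1 y : \sum_(z < k.+1 + y) ~~ b z = (\sum_(z < y) ~~ b (k.+1 + z)).+1.
  by rewrite big_split_ord /= big_ord_recr /= b0 c0 // addn0 add0n add1n.
rewrite -(subnKC (_ : k.+1 <= n)); last by lia.
rewrite big_split_ord /=; case: i hi => [|i] hi /=.
  rewrite [X in _ + X]big1 ?addn0 => [|y _]; last by rewrite c1 andbF.
  rewrite -[RHS](@sum_lt k.+1) //; apply: eq_bigr => y _.
  have yk : y <= k by rewrite -ltnS.
  rewrite c0 // andbT; case: (ltnP y k) => [/b1->//|ky].
  by rewrite (_ : nat_of_ord y = k) ?b0 //; lia.
rewrite big1 ?add0n => [|y _]; last first.
  have yk : y <= k by rewrite -ltnS.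
  by rewrite c0 // andbF.
rewrite -(IH i (n - k.+1) (fun y => b (k.+1 + y))) //.
- by apply: eq_bigr => y _; rewrite c1 eqSS.
- move=> y hy; rewrite hb /fields /= ?size_cat ?size_encode_nat ?ltn_add2l //.
  by rewrite nth_cat size_encode_nat ltnNge leq_addr addKn.
- by move: hn; rewrite -/(fields ks); lia.
Qed.

End Field.

Section Denotation.
Variables (n : nat) (M : nat -> nat).
Implicit Types (V : nat -> nat) (e : exp).

(** Quantifying over all valuations that agree below 10 makes a denotation stable under the binders
    of the macros. *)
Definition den V e (a : nat) : Prop :=
  forall V', (forall x, x < 10 -> V' x = V x) -> eval n V' M e = a.

(** Every nonzero value is true, so that [EAdd] reads as a disjunction and [ESum] as an existential
    quantifier. *)
Definition holds V e (P : Prop) : Prop :=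
  exists2 a, den V e a & a != 0 <-> P.

Lemma den_eval V e a : den V e a -> eval n V M e = a.
Proof. by move=> h; exact: h. Qed.

Lemma den_var V x : x < 10 -> den V (EVar x) (V x).
Proof. by move=> x10 V' /(_ _ x10). Qed.

Lemma den_cst V k : den V (ECst k) k.
Proof. by []. Qed.

Lemma den_len V : den V ELen n.
Proof. by []. Qed.

Lemma den_add V e1 e2 a b : den V e1 a -> den V e2 b -> den V (EAdd e1 e2) (a + b).
Proof. by move=> h1 h2 V' h /=; rewrite h1 // h2. Qed.

Lemma den_sub V e1 e2 a b : den V e1 a -> den V e2 b -> den V (ESub e1 e2) (a - b).
Proof. by move=> h1 h2 V' h /=; rewrite h1 // h2. Qed.

Lemma den_get V e a : den V e a -> den V (EGet e) (M a).
Proof. by move=> h1 V' h /=; rewrite h1. Qed.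

Lemma upd_low V' V x v : 10 <= x -> (forall y, y < 10 -> V' y = V y) ->
  forall y, y < 10 -> upd V' x v y = V y.
Proof. by move=> x10 h y y10; rewrite /upd (_ : (y == x) = false) ?h //; lia. Qed.

Lemma upd_same V' V x v : (forall y, y < 10 -> V' y = V y) ->
  forall y, y < 10 -> upd V' x v y = upd V x v y.
Proof. by move=> h y y10; rewrite /upd h. Qed.

(** Exactly [a] of the [n] values of the counter pass the guard; this is where [a <= n] enters. *)
Lemma den_mul V e1 e2 a b :
  den V e1 a -> den V e2 b -> a <= n -> den V (EMul e1 e2) (a * b).
Proof.
move=> h1 h2 an V' h /=.
rewrite -(sum_lt an) big_distrl /=; apply: eq_bigr => j _.
rewrite (h1 (upd V' 10 j)) ?(h2 (upd V' 10 j)); try exact: upd_low.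
by rewrite subn_eq0 ltnNge; case: leqP; rewrite ?mul0n ?mul1n.
Qed.

Lemma den_field V e1 e2 p i ks :
  den V e1 p -> den V e2 i -> i < size ks -> size (fields ks) <= n ->
  (forall y, y < size (fields ks) -> M (p + y) = nth false (fields ks) y) ->
  den V (EField e1 e2) (nth 0 ks i).
Proof.
move=> h1 h2 ik ksn hM V' h.
rewrite -(@count_fields ks i n (fun y => M (p + y) != 0)) //=; last first.
  by move=> y hy; rewrite hM //; case: nth.
apply: eq_bigr => y _.
have hy : forall x, x < 10 -> upd V' 11 y x = V x by exact: upd_low.
rewrite h1 // h2 // [upd V' 11 y 11]/=.
set c := \sum_(z < n) _.
have -> : c = \sum_(z < y) (M (p + z) == 0).
  rewrite (big_ord_widen n (fun z => nat_of_bool (M (p + z) == 0))) ?big_mkcond //=;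
    last exact: ltnW.
  apply: eq_bigr => z _; rewrite h1; last exact: upd_low.
  rewrite /upd /= subn_eq0 ltnNge; case: leqP => //= _.
  by case: (M _) => // k; rewrite subn_eq0.
rewrite /upd /=; case: (M (p + y)) => //= m.
rewrite (eq_bigr (fun z : 'I_y => nat_of_bool (~~ (M (p + z) != 0)))).
  by set d := \sum_(z < y) _; case: eqP => [->|]; lia.
by move=> z _; rewrite negbK.
Qed.

(** Double negation normalises every nonzero value to 1, which lets a truth value serve as a
    cost. *)
Lemma den_not2 V e (b : bool) : holds V e b -> den V (ENot (ENot e)) b.
Proof.
move=> [a h ab] V' hV /=; rewrite h //.
have -> : b = (a != 0) by apply/idP/idP => /ab.
by case: eqP => /=; lia.
Qed.

Lemma holds_iff V e P Q : holds V e P -> (P <-> Q) -> holds V e Q.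
Proof. by move=> [a h hP] PQ; exists a => //; rewrite hP. Qed.

Lemma holds_nonzero V e a : den V e a -> holds V e (a != 0).
Proof. by move=> h; exists a. Qed.

Lemma holds_lt V e1 e2 a b : den V e1 a -> den V e2 b -> holds V (ESub e1 e2) (b < a).
Proof.
by move=> h1 h2; exists (a - b); [exact: den_sub|rewrite -lt0n subn_gt0].
Qed.

Lemma holds_eq V e1 e2 a b : den V e1 a -> den V e2 b -> holds V (EEq e1 e2) (a = b).
Proof.
move=> h1 h2; exists (1 - ((a - b) + (b - a))).
  by do ![apply: den_sub|apply: den_add].
by split; lia.
Qed.

Lemma holds_not V e P : holds V e P -> holds V (ENot e) (~ P).
Proof.
move=> [a h hP]; exists (1 - a); first exact: den_sub.
by rewrite -hP; split; [move=> h1; lia|move/negP; lia].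
Qed.

Lemma holds_add V e1 e2 P Q : holds V e1 P -> holds V e2 Q -> holds V (EAdd e1 e2) (P \/ Q).
Proof.
move=> [a h1 hP] [b h2 hQ]; exists (a + b); first exact: den_add.
by rewrite -hP -hQ addn_eq0 negb_and; split=> /orP.
Qed.

(** The second expression needs a meaning only under the first condition; thus range tests protect
    the reading of numbers as states or atoms. *)
Lemma holds_guard V e1 e2 P Q :
  holds V e1 P -> (P -> holds V e2 Q) -> holds V (EGuard e1 e2) (P /\ Q).
Proof.
move=> [a h1 hP] h2; case: (eqVneq a 0) => a0.
  exists 0 => [V' hV /=|]; first by rewrite h1 // a0.
  by split=> // -[/hP]; rewrite a0.
have [b h hQ] := h2 (hP.1 a0); exists b => [V' hV /=|]; first by rewrite h1 // (negbTE a0) h.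
by rewrite hQ; split=> [|[]] //; split=> //; apply/hP.
Qed.

Lemma holds_sum V x e (P : nat -> Prop) : x < 10 ->
  (forall j, j < n -> holds (upd V x j) e (P j)) ->
  holds V (ESum x e) (exists2 j, j < n & P j).
Proof.
move=> x10 h.
have hf (j : 'I_n) : exists a, den (upd V x j) e a /\ (a != 0 <-> P j).
  by have [a h1 h2] := h j (ltn_ord j); exists a.
have [f hf'] := fin_all_exists hf.
exists (\sum_(j < n) f j).
  move=> V' hV /=; apply: eq_bigr => j _; have [h1 _] := hf' j.
  by apply: h1; exact: upd_same.
rewrite sum_nat_eq0 negb_forall; split.
  by move=> /existsP[j fj]; exists j => //; have [_ <-] := hf' j.
move=> [j jn Pj]; apply/existsP; exists (Ordinal jn).
by have [_ h2] := hf' (Ordinal jn); apply/h2.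
Qed.

End Denotation.

(** * Levenshtein distance to a finite word *)

Section Levenshtein.
Variable A : eqType.
Implicit Types (v w : seq A) (g : seq (option A * option A)).

Definition proper_edit (e : option A * option A) := isSome e.1 || isSome e.2.
(** Among proper edits, equal components can only be [(Some a, Some a)], the free edits. *)
Definition costly_edit (e : option A * option A) := e.1 != e.2.

(** The weight is exact rather than minimal, which makes the recursion on the last edit an
    equivalence. *)
Definition edits (k : nat) v w : Prop :=
  exists g, [/\ all proper_edit g, pmap fst g = v, pmap snd g = w &
                count costly_edit g = k].

Lemma pmap_map (B C D : Type) (f : C -> option D) (h : B -> C) s :
  pmap f (map h s) = pmap (f \o h) s.
Proof. by elim: s => //= b s ->. Qed.

(** Delete all of [v], then insert all of [w]. *)
Lemma edits_trivial v w : edits (size v + size w) v w.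
Proof.
exists ([seq (Some a, None) | a <- v] ++ [seq (None, Some a) | a <- w]).
have pN (s : seq A) : pmap (fun=> @None A) s = [::] by elim: s.
have pS (s : seq A) : pmap Some s = s by elim: s => //= a s ->.
rewrite all_cat !all_map !pmap_cat count_cat !count_map !pmap_map.
rewrite /comp /= !pN !pS cats0; split=> //.
by rewrite !all_predT.
Qed.

Lemma iota_succ i : iota 0 i.+1 = 0 :: [seq j.+1 | j <- iota 0 i].
Proof. by rewrite /= -[1]addn0 iotaDl. Qed.

Lemma erases_to_pmap (s : seq (option A)) : erases_to (Fin s) (Fin (pmap id s)).
Proof.
elim: s => [|o s IH] k a /=.
  by split=> [|[i []]]; rewrite onth_default.
have cnt i : count (nonempty_at (Fin (o :: s))) (iota 0 i.+1) =
    isSome o + count (nonempty_at (Fin s)) (iota 0 i).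
  by rewrite iota_succ [LHS]/= count_map; case: o.
split.
  case: o cnt => [b|] cnt /=; last first.
    by move=> /IH[i [hi hc]]; exists i.+1; rewrite cnt.
  case: k => [[->]|k /IH[i [hi hc]]]; first by exists 0.
  by exists i.+1; rewrite cnt hc.
move=> [[|i] [hi hk]]; first by case: hi => -> in hk *; rewrite -hk.
by move: hk; rewrite cnt => <-; move: hi; case: o {cnt} => [b|] hi; apply/IH; exists i.
Qed.

Lemma erases_to_uniq (u : word (option A)) (v w : word A) :
  erases_to u v -> erases_to u w -> letter v =1 letter w.
Proof.
move=> hv hw k; case E: (letter v k) => [a|]; first by symmetry; apply/hw/hv.
by case E' : (letter w k) => [a|] //; rewrite -E; apply/hv/hw.
Qed.

Lemma letter_fin (v : word A) s : letter v =1 letter (Fin s) -> v = Fin s.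
Proof.
case: v => [t|f] h; last by have := h (size s); rewrite /= onth_default.
by congr Fin; apply: eq_from_onth.
Qed.

Lemma edit_sequence_fin v w g :
  edit_sequence (Fin v) (Fin w) (Fin g) <->
  [/\ all proper_edit g, pmap fst g = v & pmap snd g = w].
Proof.
have prop : (forall i, letter (Fin g) i <> Some (None, None)) <->
    all proper_edit g.
  split=> [h|/allP h i /= hi].
    apply/(all_nthP (None, None)) => i lt; have := h i.
    rewrite /= onthE (nth_map (None, None)) //.
    by case: (nth _ _ _) => -[?|] [?|].
  have lt : i < size g.
    by rewrite ltnNge; apply/negP => ge; rewrite onth_default in hi.
  have := h (None, None); rewrite /proper_edit /= => H; apply/notF/H.
  move: hi; rewrite onthE (nth_map (None, None)) // => -[<-].
  exact: mem_nth.
have pm1 f : pmap f g = pmap id (map f g) by rewrite pmap_map.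
rewrite !pm1; split=> [[/prop -> e1 e2]|[/prop h <- <-]].
  split=> //.
    by have [] := letter_fin (erases_to_uniq e1 (erases_to_pmap _)).
  by have [] := letter_fin (erases_to_uniq e2 (erases_to_pmap _)).
by split=> //; exact: erases_to_pmap.
Qed.

Lemma edit_sequence_fin_inf v f g : ~ edit_sequence (Fin v) (Inf f) (Fin g).
Proof.
move=> [_ _ e]; have := letter_fin (erases_to_uniq e (erases_to_pmap _)).
by [].
Qed.

Lemma weight_fin g :
  all proper_edit g -> weight (Fin g) = ((count costly_edit g)%:R%:E)%R.
Proof.
move=> pg; set s := [seq i <- iota 0 (size g) |
  costly_edit (nth (None, None) g i)].
have E : edit_positions (Fin g) = [set` [fset i in s]%fset]%classic.
  apply/seteqP; split=> i /=.
    move=> [e [he hne]]; rewrite inE /= mem_filter mem_iota.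
    have lt : i < size g.
      by rewrite ltnNge; apply/negP => ge; rewrite /= onth_default in he.
    rewrite lt andbT; move: he; rewrite /= onthE (nth_map (None, None)) // => -[Ee].
    have := all_nthP (None, None) pg i lt; rewrite Ee leq0n andbT.
    case: e {Ee} hne => -[a|] [b|] // h _; apply/eqP => -[ab].
    by apply: (h a); rewrite ab.
  rewrite inE /= mem_filter mem_iota add0n => /andP[c /andP[_ lt]].
  exists (nth (None, None) g i); split; first by rewrite /= onthE (nth_map (None, None)).
  by move=> a e; move: c; rewrite e /costly_edit eqxx.
rewrite /weight E asboolT; last exact: finite_fset.
congr (_%:R%:E)%R; rewrite set_fsetK card_fseq undup_id; last first.
  by rewrite filter_uniq ?iota_uniq.
rewrite size_filter -[g in RHS](mkseq_nth (None, None)) count_map.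
by [].
Qed.

(** An infinite edit sequence consumes only finitely many letters of the finite word [v]; from some
    point on all its edits are insertions, hence costly. *)
Lemma weight_inf v (w : word A) f :
  edit_sequence (Fin v) w (Inf f) -> weight (Inf f) = +oo%E.
Proof.
move=> [_ e _]; rewrite /weight asboolF // => fin.
set u := wmap fst (Inf f) in e.
have bound i : nonempty_at u i -> count (nonempty_at u) (iota 0 i) < size v.
  rewrite /nonempty_at; case E: (letter u i) => [[a|]|] // _.
  have /e : exists j, letter u j = Some (Some a) /\
      count (nonempty_at u) (iota 0 j) = count (nonempty_at u) (iota 0 i).
    by exists i.
  by rewrite ltnNge => /= h; apply/negP => ge; rewrite onth_default in h.
have [[N hN]|hN] := pselect (exists N, forall i, N <= i -> ~~ nonempty_at u i).
  apply: infinite_nat.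
  (* Every position from [N] on is costly, so shifting the costly positions down by [N] covers all
     of [nat]. *)
  have : finite_set ((fun i => i - N) @` edit_positions (Inf f))%classic.
    exact: finite_image.
  apply: sub_finite_set => i _; exists (i + N); last by rewrite addnK.
  exists (f (i + N)); split=> // a E.
  by have := hN _ (leq_addl i N); rewrite /nonempty_at /= E.
(* Without such an [N], nonempty positions recur forever and their count exceeds [size v]. *)
have large k : exists2 i, nonempty_at u i & k <= count (nonempty_at u) (iota 0 i).
  elim: k => [|k [i ne le]].
    apply: contrapT => h; apply: hN; exists 0 => i _; apply/negP => ne.
    by apply: h; exists i.
  apply: contrapT => h; apply: hN; exists i.+1 => j ij; apply/negP => ne'.
  apply: h; exists j => //; rewrite -(subnKC ij) iotaD count_cat.
  by rewrite -[i.+1]addn1 iotaD count_cat /= add0n ne; lia.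
have [i /bound] := large (size v); rewrite ltnNge => /negP//.
Qed.

(** Some finite edit sequence exists, so a least finite weight does; infinite sequences weigh [+oo]
    and cannot undercut it. *)
Lemma dLev_fin v w :
  exists k, [/\ edits k v w, forall k', edits k' v w -> k <= k' &
               dLev (Fin v) (Fin w) = (k%:R%:E)%R].
Proof.
have ex : exists k, `[< edits k v w >].
  by exists (size v + size w); apply/asboolP/edits_trivial.
case: (ex_minnP ex) => k /asboolP hk kmin.
have {}kmin k' : edits k' v w -> k <= k' by move=> h; apply/kmin/asboolP.
exists k; split=> //.
have kin : edit_weights (Fin v) (Fin w) (k%:R%:E)%R.
  have [g [h1 h2 h3 h4]] := hk; exists (Fin g); last by rewrite weight_fin ?h4.
  exact/edit_sequence_fin.
have klb : lbound (edit_weights (Fin v) (Fin w)) (k%:R%:E)%R.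
  move=> _ [[g|f] h <-]; last by rewrite (weight_inf h) leey.
  have [h1 h2 h3] := (edit_sequence_fin _ _ _).1 h.
  by rewrite weight_fin // lee_fin Num.Theory.ler_nat; apply: kmin; exists g.
rewrite /dLev; case: xgetP => [y -> [yin ylb]|/(_ (k%:R%:E)%R)[]//].
by apply/eqP; rewrite Order.POrderTheory.eq_le; apply/andP; split; [exact: ylb|exact: klb].
Qed.

(** A finite edit sequence erases to finite words only, so a weight chosen by [xget] belongs to an
    infinite sequence; the default of [xget] is [+oo] as well. *)
Lemma dLev_inf v f : dLev (Fin v) (Inf f) = +oo%E.
Proof.
rewrite /dLev; case: xgetP => // y -> [[[g /edit_sequence_fin_inf//|h hs <-]] _].
exact: weight_inf hs.
Qed.

End Levenshtein.

(** * Paths and counterfactual causes *)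

Section EditsLast.
Variable A : eqType.
Implicit Types (v w : seq A).

Lemma edits_delete k v w a : edits k v w -> edits k.+1 (rcons v a) w.
Proof.
move=> [g [g1 <- <- g4]]; exists (rcons g (Some a, None)).
rewrite -!cats1 all_cat !pmap_cat count_cat g1 g4 /= cats0.
by split=> //; rewrite addn1.
Qed.

Lemma edits_insert k v w b : edits k v w -> edits k.+1 v (rcons w b).
Proof.
move=> [g [g1 <- <- g4]]; exists (rcons g (None, Some b)).
rewrite -!cats1 all_cat !pmap_cat count_cat g1 g4 /= cats0.
by split=> //; rewrite addn1.
Qed.

Lemma edits_subst k v w a b :
  edits k v w -> edits (k + (a != b)) (rcons v a) (rcons w b).
Proof.
move=> [g [g1 <- <- g4]]; exists (rcons g (Some a, Some b)).
rewrite -!cats1 all_cat !pmap_cat count_cat g1 g4 /= addn0.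
by split.
Qed.

(** The usual dynamic programming recurrence for edit distance, with exact weights. [EditsSubst]
    includes the match of equal letters, at cost 0. *)
Variant edits_spec : nat -> seq A -> seq A -> Prop :=
| EditsNil : edits_spec 0 [::] [::]
| EditsDelete k v w a : edits k v w -> edits_spec k.+1 (rcons v a) w
| EditsInsert k v w b : edits k v w -> edits_spec k.+1 v (rcons w b)
| EditsSubst k v w a b :
    edits k v w -> edits_spec (k + (a != b)) (rcons v a) (rcons w b).

Lemma editsP k v w : edits k v w -> edits_spec k v w.
Proof.
move=> [g [+ <- <- <-]]; case/lastP: g => [|g e]; first by constructor.
rewrite -cats1 all_cat !pmap_cat count_cat /= => /andP[g1].
have eg : edits (count (@costly_edit A) g) (pmap fst g) (pmap snd g) by exists g.
case: e => [[a|] [b|]] //= _; rewrite ?cats1 ?cats0 ?addn1 ?addn0.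
- exact: EditsSubst.
- exact: EditsDelete.
- exact: EditsInsert.
Qed.

(** With nothing to consume, every edit is a costly insertion. *)
Lemma edits_nill k w : edits k [::] w <-> k = size w.
Proof.
split=> [[g [g1 g2 <- <-]]|->]; last exact: (edits_trivial [::]).
elim: g g1 g2 => //= -[[a|] [b|]] g IH //= g1 g2.
by rewrite IH.
Qed.

End EditsLast.

(** * Finite and infinite paths avoiding C *)

Section Paths.
Variables (AP S : finType) (T : transition_system AP S) (C : {set S}).
Implicit Types (p : seq S) (o : option S) (s t : S).

Definition olast p : option S := if p is s :: q then Some (last s q) else None.

Definition edge o t : bool := if o is Some s then trans T s t else t == init T.

Definition safe p : bool :=
  if p is s :: q then [&& s == init T, path (trans T) s q & all [in ~: C] p]
  else true.

Lemma olast_rcons p t : olast (rcons p t) = Some t.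
Proof. by case: p => //= s q; rewrite last_rcons. Qed.

Lemma safe_rcons p t : safe (rcons p t) = [&& safe p, edge (olast p) t & t \notin C].
Proof.
case: p => [|s q] /=; first by rewrite inE andbT.
rewrite rcons_path all_rcons !inE.
by case: (s == _) (path _ _ _) (trans _ _ _) (s \in C) (t \in C) (all _ _) => [] [] [] [] [] [].
Qed.

Lemma maximal_safe_fin p :
  maximal_path T (Fin p) /\ always (~: C) (Fin p) <->
  safe p /\ exists2 t, olast p = Some t & t \in terminal T.
Proof.
have al : always (~: C) (Fin p) <-> all [in ~: C] p.
  split=> [h|/allP h i s /= hi].
    case: p h => // s p h; apply/(all_nthP s) => i lt.
    by apply: (h i); rewrite /= onthE (nth_map s).
  apply: h; move: hi; rewrite onthE.
  case: (ltnP i (size p)) => lt; last by rewrite nth_default // size_map.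
  by rewrite (nth_map s) // => -[<-]; exact: mem_nth.
case: p al => [|s p] al.
  by split=> [[[[]]]|[_ []]].
have onthn i : i < size (s :: p) ->
    letter (Fin (s :: p)) i = Some (nth s (s :: p) i).
  by move=> lt; rewrite /letter onthE (nth_map s).
split=> [[[[[h1] h2] h3] /al h4]|[/and3P[/eqP h1 /(pathP s) h2 h3] [t [ht] tt]]].
  split.
    apply/and3P; split; [by rewrite h1| |exact: h4].
    apply/(pathP s) => i lt.
    by apply: (h2 i); rewrite /= onthE (nth_map s) // ltnW.
  exists (last s p) => //; apply: (h3 (size p)); last by rewrite /= onth_default.
  by rewrite onthn // nth_last.
split; last exact/al.
split; first split; first by rewrite onthn //= h1.
- move=> i a b ha hb.
  have lt : i < size p.
    rewrite ltnNge; apply/negP => ge.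
    by move: hb; rewrite /= onth_default.
  move: ha hb; rewrite onthn; last exact: ltnW.
  rewrite (onthn i.+1) // => -[<-] [<-]; exact: h2.
- move=> i a ha hn.
  have {hn} ge : size p <= i.
    by rewrite leqNgt; apply/negP => lt; move: hn; rewrite onthn.
  have le : i <= size p.
    by rewrite leqNgt; apply/negP => lt; move: ha; rewrite /= onth_default.
  have ei : i = size p by lia.
  move: ha; rewrite ei onthn // => -[<-].
  by rewrite nth_last /= ht.
Qed.

Lemma always_notE (A : {set S}) r : always (~: A) r <-> ~ eventually A r.
Proof.
split=> [h [i [s [hi sA]]]|h i s hi]; first by have := h i s hi; rewrite inE sA.
by rewrite inE; apply/negP => sA; apply: h; exists i, s.
Qed.

(** States of [E] have no successor, so a path can meet [E] only in its last state. *)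
Lemma eventually_fin (E : {set S}) p t : E \subset terminal T ->
  maximal_path T (Fin p) -> olast p = Some t ->
  eventually E (Fin p) <-> t \in E.
Proof.
move=> /fintype.subsetP sub [[h1 h2] h3] ht.
have hl : letter (Fin p) (size p).-1 = Some t.
  case: p ht {h1 h2 h3} => // s p [<-] /=.
  by rewrite onthE (nth_map s) // nth_last.
split=> [[i [s [hi sE]]]|tE]; last by exists (size p).-1, t.
case E' : (letter (Fin p) i.+1) => [u|].
  have := sub _ sE; rewrite inE => /forallP/(_ u).
  by rewrite (h2 _ _ _ hi E').
have -> : t = s; last by [].
apply: Some_inj; rewrite -hl -hi; congr letter.
have lt : i < size p.
  by rewrite ltnNge; apply/negP => ge; move: hi; rewrite /= onth_default.
suff : ~~ (i.+1 < size p) by lia.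
by apply/negP => lt'; move: E'; rewrite /letter onthE (nth_map s).
Qed.

Lemma eventually_inf (E : {set S}) f : E \subset terminal T ->
  is_path T (Inf f) -> ~ eventually E (Inf f).
Proof.
move=> /fintype.subsetP sub [_ h] [i [_ [[<-] fE]]].
have := sub _ fE; rewrite inE => /forallP/(_ (f i.+1)).
by rewrite (h i).
Qed.

(** Cutting out loops keeps the last state and leaves each state at most once. *)
Lemma safe_shorten p t : safe p -> olast p = Some t ->
  exists p', [/\ safe p', olast p' = Some t & size p' <= #|S|].
Proof.
case: p => // s p /and3P[/eqP -> hp ha] [].
case: (shortenP hp) => p' hp' up' sub <-.
exists (init T :: p'); split=> //; last by rewrite -(card_uniqP up') max_card.
rewrite /safe eqxx hp' /=.
move: ha => /= /andP[-> /allP ha]; apply/allP => x xp'; exact/ha/sub.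
Qed.

(** Forwards, take a prefix. Backwards, a path of [#|S|.+1] states repeats one of them, and the
    segment between the two occurrences can be run through forever. *)
Lemma infinite_safeP :
  (exists f, maximal_path T (Inf f) /\ always (~: C) (Inf f)) <->
  exists p, safe p /\ size p = #|S|.+1.
Proof.
split=> [[f [[[[f0] fp] _] fC]]|[p [sp szp]]].
  exists (mkseq f #|S|.+1); rewrite size_mkseq; split=> //.
  rewrite /safe /= f0 eqxx /=; apply/andP; split.
    apply/(pathP (init T)) => i; rewrite size_map size_iota => lt.
    have -> : init T :: [seq f i0 | i0 <- iota 1 #|S|] = mkseq f #|S|.+1.
      by rewrite /mkseq /= f0.
    rewrite nth_mkseq ?(nth_map 0) ?size_iota ?nth_iota //; last exact: ltnW.
    exact: (fp i).
  have := fC 0 (init T); rewrite /= f0 => -> //=.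
  by apply/allP => _ /mapP[i _ ->]; exact: (fC i).
case: p sp szp => // s p /and3P[/eqP es /(pathP s) hp /(all_nthP s) ha] szp.
have : ~~ uniq (s :: p).
  by apply/negP => /card_uniqP u; have := max_card [in s :: p]; rewrite u szp ltnn.
case/(uniqPn s) => a [b [ab bs eab]].
(* [g] goes round between the positions [a] and [b] of the repeated state. *)
pose fix g i := if i is j.+1 then if (g j).+1 == b then a else (g j).+1 else 0.
have gb i : g i < b.
  elim: i => [|i IH] /=; first lia.
  by case: eqP => // /eqP ne; lia.
exists (fun i => nth s (s :: p) (g i)); split.
  split=> //; split=> /=; first by rewrite es.
  move=> i _ _ [<-] [<-].
  (* At the wrap-around, positions [a] and [b] carry the same state, so the step from [b - 1] to [a]
     is a transition of the path. *)
  have -> : nth s (s :: p) (g i.+1) = nth s p (g i).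
    by rewrite /=; case: eqP => // <- in eab *; rewrite eab.
  by apply: hp; have := gb i; move: bs => /=; lia.
by move=> i _ [<-]; apply: ha; exact: ltn_trans (gb i) bs.
Qed.

(** * Reduction of causality to the table *)

Section Decision.
Variable v : seq {set AP}.
Notation L := (map (label T)).

(* [None] stands for the end of the empty path, which makes entering the initial
   state a step like any other. *)
Definition cell (w i : nat) (o : option S) : Prop :=
  exists p, [/\ safe p, olast p = o & edits w (take i v) (L p)].

(** Deletion and substitution consume a letter of [v]; insertion and substitution extend the path by
    [t]. A matching letter leaves [w] unchanged but lowers [i]. *)
Variant cell_spec (w i : nat) (o : option S) : Prop :=
| CellStart of w = 0 & i = 0 & o = None
| CellDelete w' i' of w = w'.+1 & i = i'.+1 & cell w' i' o
| CellInsert w' o' t of w = w'.+1 & o = Some t & t \notin C & edge o' t &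
    cell w' i o'
| CellSubst w' i' o' t of w = w' + (nth finset.set0 v i' != label T t) & i = i'.+1 &
    o = Some t & t \notin C & edge o' t & cell w' i' o'.

Lemma cellP w i o : i <= size v -> cell w i o <-> cell_spec w i o.
Proof.
have taker i' : i' < size v -> take i'.+1 v = rcons (take i' v) (nth finset.set0 v i').
  exact: take_nth.
move=> iv; split.
  move=> [p [sp po]]; move Ex : (take i v) => x; move Ey : (L p) => y /editsP e.
  case: e Ex Ey => [|k x' y' a e|k x' y' b e|k x' y' a b e] Ex Ey.
  - apply: CellStart => //; last by rewrite -po; case: p Ey {sp po}.
    by move: Ex iv; case: i => // i; case: (v).
  - case: i iv Ex => [|i] iv; first by rewrite take0; case: (x').
    rewrite taker // => /rcons_inj[Ex _].
    by apply: (CellDelete (w' := k) (i' := i)) => //; exists p; rewrite Ex Ey.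
  - case/lastP: p sp po Ey => [|p t]; first by case: (y').
    rewrite safe_rcons olast_rcons map_rcons => /and3P[sp et tC] <- /rcons_inj[Ey _].
    by apply: (CellInsert (w' := k) (o' := olast p) (t := t)) => //; exists p; rewrite Ey Ex.
  - case/lastP: p sp po Ey => [|p t]; first by case: (y').
    rewrite safe_rcons olast_rcons map_rcons => /and3P[sp et tC] <- /rcons_inj[Ey Eb].
    case: i iv Ex => [|i] iv; first by rewrite take0; case: (x').
    rewrite taker // => /rcons_inj[Ex Ea].
    apply: (CellSubst (w' := k) (i' := i) (o' := olast p) (t := t)); rewrite ?Ea ?Eb //.
    by exists p; rewrite Ey Ex.
case=> [-> -> ->|w' i' -> ei [p [sp po e]]|w' o' t -> -> tC et [p [sp po e]]
    |w' i' o' t -> ei -> tC et [p [sp po e]]].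
- by exists [::]; rewrite take0; split=> //; exact/edits_nill.
- by exists p; rewrite ei taker -?ei //; split=> //; exact: edits_delete.
- exists (rcons p t); rewrite safe_rcons olast_rcons map_rcons po et sp tC.
  by split=> //; exact: edits_insert.
- exists (rcons p t); rewrite safe_rcons olast_rcons map_rcons po et sp tC.
  by rewrite ei taker -?ei //; split=> //; exact: edits_subst.
Qed.

(** Row [i = 0] records lengths of paths; the test for infinite paths reads it. *)
Lemma cell_start w s : cell w 0 (Some s) <->
  exists p, [/\ safe p, olast p = Some s & size p = w].
Proof.
split=> [[p [sp po]]|[p [sp po szp]]].
  by rewrite take0 => /edits_nill ->; exists p; rewrite size_map.
by exists p; rewrite take0; split=> //; apply/edits_nill; rewrite size_map.
Qed.

Definition ends (w : nat) (A : {set S}) : Prop :=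
  exists2 t, t \in A & cell w (size v) (Some t).

(** [X] will hold the terminal states at which [Phi] fails and [Y] those at which it holds; [n] will
    be the input length. *)
Variables (X Y : {set S}) (n : nat).
Hypothesis XYterm : X :|: Y = terminal T.
Hypothesis XYdisj : [disjoint X & Y].
Hypothesis n_large : size v + #|S| < n.

(** Shorten the path and rewrite the whole trace. This makes a search over weights below [n]
    complete. *)
Lemma ends_small w A : ends w A -> exists2 w', w' < n & ends w' A.
Proof.
move=> [t tA [p [sp po _]]].
have [p' [sp' po' sz']] := safe_shorten sp po.
exists (size v + size p').
  by apply: leq_ltn_trans n_large; rewrite leq_add2l.
exists t => //; exists p'; split=> //.
by rewrite take_size -(size_map (label T) p'); exact: edits_trivial.
Qed.

(** Equality [w' = w] is included because at a tie some nearest path satisfies [Phi]. The weight [w]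
    may be any one below those of [Y], not only the least. *)
Definition wins : Prop :=
  exists w, [/\ w < n, ends w X & forall w', w' <= w -> ~ ends w' Y].

Definition no_end : Prop := forall w, w < n -> ~ ends w X /\ ~ ends w Y.

Variables (pi : seq S) (Phi : word S -> Prop).
Hypothesis pi_trace : L pi = v.
Hypothesis PhiP : forall p t, maximal_path T (Fin p) -> olast p = Some t ->
  t \in terminal T -> Phi (Fin p) <-> t \in Y.

Let d := @dLev_path AP S T (Fin pi).

Lemma d_inf f : d (Inf f) = +oo%E.
Proof. exact: dLev_inf. Qed.

Lemma d_fin p : exists k, [/\ edits k v (L p),
  forall k', edits k' v (L p) -> k <= k' & d (Fin p) = (k%:R%:E)%R].
Proof. by rewrite -pi_trace; exact: dLev_fin. Qed.

(** If a finite candidate exists, the nearest paths are finite and the least weights for [X] and [Y]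
    decide. Otherwise all candidates are infinite, all at distance [+oo], and hence all nearest. *)
Lemma counterfactual_causeP :
  counterfactual_cause T (dLev_path T) C Phi (Fin pi) <->
  wins \/ [/\ no_end, exists f, maximal_path T (Inf f) /\ always (~: C) (Inf f)
          & forall f, maximal_path T (Inf f) -> always (~: C) (Inf f) ->
              ~ Phi (Inf f)].
Proof.
have endsP w (A : {set S}) : A \subset terminal T -> ends w A <-> exists p t,
    [/\ maximal_path T (Fin p), always (~: C) (Fin p), olast p = Some t, t \in A
      & edits w v (L p)].
  move=> /fintype.subsetP sub; rewrite /ends; split.
    move=> [t tA [p [sp po]]]; rewrite take_size => e; exists p, t.
    have [] : maximal_path T (Fin p) /\ always (~: C) (Fin p); last by [].
    by apply/maximal_safe_fin; split=> //; exists t => //; exact: sub.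
  move=> [p [t [mp ap po tA e]]]; exists t => //; exists p; rewrite take_size.
  by have [] := (maximal_safe_fin p).1 (conj mp ap).
have subX : X \subset terminal T by rewrite -XYterm finset.subsetUl.
have subY : Y \subset terminal T by rewrite -XYterm finset.subsetUr.
have finends p : maximal_path T (Fin p) -> always (~: C) (Fin p) ->
    exists w, d (Fin p) = (w%:R%:E)%R /\
      ((ends w X /\ ~ Phi (Fin p)) \/ (ends w Y /\ Phi (Fin p))).
  move=> mp ap; have [k [e _ dk]] := d_fin p; exists k; split=> //.
  have [_ [t po tt]] := (maximal_safe_fin p).1 (conj mp ap).
  have /orP[tX|tY] : (t \in X) || (t \in Y) by rewrite -finset.in_setU XYterm.
    left; split; first by apply/endsP => //; exists p, t.
    by move=> /(PhiP mp po tt) tY; have := disjointFr XYdisj tX; rewrite tY.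
  right; split; first by apply/endsP => //; exists p, t.
  exact/(PhiP mp po tt).
(* An exact weight in the table only bounds the distance from above. *)
have lbd w (A : {set S}) : A \subset terminal T -> ends w A ->
    exists p t, [/\ maximal_path T (Fin p), always (~: C) (Fin p),
      olast p = Some t, t \in A & (d (Fin p) <= w%:R%:E)%O%R].
  move=> sub /(endsP _ _ sub)[p [t [mp ap po tA e]]]; exists p, t; split=> //.
  have [k [_ kmin ->]] := d_fin p.
  by rewrite lee_fin Num.Theory.ler_nat; exact: kmin.
split.
- move=> [[r [mr ar]] hmin].
  have [[w0 hw0]|nofin] := pselect (exists w, ends w X \/ ends w Y).
    left; have ex : exists w, `[< ends w X \/ ends w Y >] by exists w0; apply/asboolP.
    case: (ex_minnP ex) => w /asboolP hw wmin.
    have {}wmin w' : ends w' X \/ ends w' Y -> w <= w'.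
      by move=> h; apply/wmin/asboolP.
    (* [w] is the least weight of any end, so a path ending in [Y] with weight at most [w] would be
       nearest and yet satisfy [Phi]. *)
    have noY w' : w' <= w -> ~ ends w' Y.
      move=> w'w hY; have [p [t [mp ap po tY dp]]] := lbd _ _ subY hY.
      apply: (hmin (Fin p)) => //; last first.
        by apply/(PhiP mp po) => //; exact: (fintype.subsetP subY).
      rewrite -/d; move=> [q|f] mq aq; last by rewrite d_inf leey.
      have [k [-> hk]] := finends q mq aq.
      apply: Order.POrderTheory.le_trans dp _.
      rewrite lee_fin Num.Theory.ler_nat; apply: leq_trans w'w (wmin _ _).
      by case: hk => -[]; [left|right].
    have hX : ends w X by case: hw => // /(noY w (leqnn w)).
    exists w; split=> //.
    have [w' ltn hw'] := ends_small hX.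
    by apply: leq_ltn_trans ltn; apply: wmin; left.
  right; have no_end_ : no_end.
    by move=> w _; split=> h; apply: nofin; exists w; [left|right].
  have hinf q : maximal_path T (Fin q) -> ~ always (~: C) (Fin q).
    move=> mq aq; have [k [_ hk]] := finends q mq aq; apply: nofin; exists k.
    by case: hk => -[]; [left|right].
  split=> //.
    by case: r mr ar => [q /hinf//|f mf af]; exists f.
  move=> f mf af; apply: hmin => // -[q|f'] mq aq; first by case: (hinf q).
  by rewrite -/d !d_inf leey.
- move=> [[w [wn wX wY]]|[no_end_ [f [mf af]] hPhi]].
    have [p [t [mp ap po tX dp]]] := lbd _ _ subX wX.
    split; first by exists (Fin p).
    (* A nearest [r] is at distance at most [w], which excludes infinite paths and, by [wY], those
       ending in [Y]. *)
    move=> r mr ar rmin; have := rmin (Fin p) mp ap.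
    case: r mr ar {rmin} => [q|f] mq aq; rewrite -/d.
      have [k [-> [[_ //]|[kY _]] le]] := finends q mq aq.
      case: (wY k) => //; have := Order.POrderTheory.le_trans le dp.
      by rewrite lee_fin Num.Theory.ler_nat.
    by rewrite d_inf => le; have := Order.POrderTheory.le_trans le dp.
  split; first by exists (Inf f).
  move=> [q|f'] mr ar _; last exact: hPhi.
  have [k [_ hk]] := finends q mr ar.
  have [w' lt hw'] : exists2 w', w' < n & ends w' X \/ ends w' Y.
    by case: hk => -[/ends_small[w' lt h] _]; exists w'; [|left| |right].
  by have [nX nY] := no_end_ w' lt; case: hw' => [/nX|/nY].
Qed.

End Decision.
End Paths.

(** * The program *)

Definition e_states := EField (ECst 1) (ECst 0).
Definition e_atoms := EField (ECst 1) (ECst 1).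
Definition e_length := EField (ECst 1) (ECst 2).
Definition e_init := EField (ECst 1) (ECst 3).
(** The 5 counts the kind bit and the closing zeros of the four unary header fields, which start at
    address 1. *)
Definition e_trans_base :=
  EAdd (EAdd e_states e_atoms) (EAdd e_length (EAdd e_init (ECst 5))).
Definition e_label_base := EAdd e_trans_base (EMul e_states e_states).
Definition e_E_base := EAdd e_label_base (EMul e_states e_atoms).
Definition e_C_base := EAdd e_E_base e_states.
Definition e_pi_base := EAdd e_C_base e_states.

Definition e_trans s t := EGet (EAdd e_trans_base (EAdd (EMul s e_states) t)).
Definition e_label s a := EGet (EAdd e_label_base (EAdd (EMul s e_atoms) a)).
Definition e_inE s := EGet (EAdd e_E_base s).
Definition e_inC s := EGet (EAdd e_C_base s).
Definition e_pi i := EField e_pi_base i.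

(** The sum counts the atoms on which the two labels differ; the double negation turns it into a
    cost of 0 or 1. *)
Definition e_mismatch i s :=
  ENot (ENot (ESum 4 (EGuard (ESub e_atoms (EVar 4))
    (ENot (EEq (e_label (e_pi i) (EVar 4)) (e_label s (EVar 4))))))).

(** The table lies right after the input; a triple is addressed as a numeral in base the input
    length with [w] leading, so addresses grow in lexicographic order. *)
Definition e_address w i s :=
  EAdd ELen (EAdd (EMul ELen (EAdd (EMul ELen w) i)) s).
Definition e_cell w i s := EGet (e_address w i s).

(* The number of states is the code of the empty path. *)
Definition e_edge u s :=
  EAdd (EGuard (ESub e_states u) (e_trans u s))
       (EGuard (EEq u e_states) (EEq s e_init)).

Definition e_pred w i s :=
  ESum 3 (EGuard (ESub (EAdd e_states (ECst 1)) (EVar 3))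
    (EGuard (e_edge (EVar 3) s) (e_cell w i (EVar 3)))).

(** The summands are the constructors of [cell_spec]. The test on [w + 1 - c] means [c <= w], under
    which the truncated [w - c] is exact. *)
Definition e_new (w i s : exp) :=
  let pw := ESub w (ECst 1) in
  let pi := ESub i (ECst 1) in
  let c := e_mismatch pi s in
  EAdd (EAdd
    (EGuard (EEq w (ECst 0)) (EGuard (EEq i (ECst 0)) (EEq s e_states)))
    (EGuard w (EGuard i (e_cell pw pi s))))
    (EGuard (ESub e_states s) (EGuard (ENot (e_inC s)) (EAdd
      (EGuard w (e_pred pw i s))
      (EGuard i (EGuard (ESub (EAdd w (ECst 1)) c)
        (e_pred (ESub w c) pi s)))))).

(** The loops follow the lexicographic order, so the cells that the recurrence reads are already
    filled. *)
Definition table_cmd : cmd :=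
  CFor 0 (CFor 1 (CFor 2
    (CPut (e_address (EVar 0) (EVar 1) (EVar 2))
          (e_new (EVar 0) (EVar 1) (EVar 2))))).

Definition e_terminal t :=
  ENot (ESum 5 (EGuard (ESub e_states (EVar 5)) (e_trans t (EVar 5)))).
Definition e_ends (A : exp -> exp) w :=
  ESum 6 (EGuard (ESub e_states (EVar 6))
    (EGuard (A (EVar 6)) (e_cell w e_length (EVar 6)))).
Definition e_ends_E := e_ends e_inE.
Definition e_ends_N :=
  e_ends (fun t => EGuard (ENot (e_inE t)) (e_terminal t)).
Definition e_wins (X Y : exp -> exp) :=
  ESum 7 (EGuard (X (EVar 7)) (ENot (ESum 8
    (EGuard (ESub (EAdd (EVar 7) (ECst 1)) (EVar 8)) (Y (EVar 8)))))).
Definition e_none :=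
  ENot (ESum 7 (EAdd (e_ends_N (EVar 7)) (e_ends_E (EVar 7)))).
(** Looks in row 0 for a path of one state more than there are states, as in [infinite_safeP]. *)
Definition e_alive :=
  ESum 6 (EGuard (ESub e_states (EVar 6))
    (e_cell (EAdd e_states (ECst 1)) (ECst 0) (EVar 6))).
(** Infinite paths never meet [E]. So they violate [Reach], and their existence counts when no
    finite candidate is left; they satisfy [Avoid], where only [e_wins], with the two kinds of ends
    exchanged, can accept. *)
Definition result_exp : exp :=
  EAdd (EGuard (EGet (ECst 0))
         (EAdd (e_wins e_ends_N e_ends_E) (EGuard e_none e_alive)))
       (EGuard (ENot (EGet (ECst 0))) (e_wins e_ends_E e_ends_N)).

(** * Reading the encoded instance *)

Lemma nth_allpairs (A B D : Type) (f : A -> B -> D) (s : seq A) (t : seq B)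
    (x : A) (y : B) (z : D) i j :
  i < size s -> j < size t ->
  nth z (allpairs f s t) (i * size t + j) = f (nth x s i) (nth y t j).
Proof.
move=> + jt; elim: s i => // a s IH [|i] /= lt; rewrite nth_cat size_map.
  by rewrite jt (nth_map y).
rewrite mulSn -addnA ltnNge leq_addr /= addKn; exact: IH.
Qed.

Lemma nth_middle (A : Type) (z : A) (s1 s2 s3 : seq A) y :
  y < size s2 -> nth z (s1 ++ s2 ++ s3) (size s1 + y) = nth z s2 y.
Proof. by move=> lt; rewrite nth_cat ltnNge leq_addr addKn /= nth_cat lt. Qed.

Lemma nth_enum_rank_map (S : finType) (B : Type) (f : S -> B) (z : B) s :
  nth z [seq f t | t <- enum S] (enum_rank s) = f s.
Proof. by rewrite (nth_map s) ?nth_enum_rank // -cardE ltn_ord. Qed.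

Lemma row_major_lt p q i j : i < p -> j < q -> i * q + j < p * q.
Proof.
move=> ip jq; apply: (@leq_trans (i.+1 * q)); last by rewrite leq_mul2r ip orbT.
by rewrite mulSn addnC ltn_add2r.
Qed.

Section Encoding.
Variables (AP S : finType) (T : transition_system AP S) (E C : {set S}).
Variables (k : kind) (pi : seq S).

Let x := encode_instance T E C k pi.
Let n := size x.
Let m := #|S|.
Let a := #|AP|.
Let l := size pi.
Let s0 : nat := enum_rank (init T).

Definition rk (o : option S) : nat := if o is Some s then enum_rank s else #|S|.

Lemma rk_some s : rk (Some s) < m. Proof. exact: ltn_ord. Qed.

Lemma rk_le o : rk o <= m.
Proof. by case: o => // s; exact: ltnW (rk_some s). Qed.

Lemma rk_inj : injective rk.
Proof.
move=> [s|] [t|] //= h.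
- by congr Some; apply: enum_rank_inj; exact: val_inj.
- by have := ltn_ord (enum_rank s); rewrite h ltnn.
- by have := ltn_ord (enum_rank t); rewrite -h ltnn.
Qed.

Lemma rk_surj u : u <= m -> exists o, rk o = u.
Proof.
rewrite leq_eqVlt => /orP[/eqP ->|lt]; first by exists None.
by exists (Some (enum_val (Ordinal lt))); rewrite /= enum_valK.
Qed.

Lemma rk_surj_some u : u < m -> exists s, rk (Some s) = u.
Proof. by move=> lt; exists (enum_val (Ordinal lt)); rewrite /= enum_valK. Qed.

Let hdr := (if k is Reach then true else false) :: fields [:: m; a; l; s0].
Let TR := [seq trans T s t | s <- enum S, t <- enum S].
Let LB := [seq b \in label T s | s <- enum S, b <- enum AP].
Let EB := [seq s \in E | s <- enum S].
Let CB := [seq s \in C | s <- enum S].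
Let PB := fields [seq nat_of_ord (enum_rank s) | s <- pi].

Lemma encodeE : x = hdr ++ TR ++ LB ++ EB ++ CB ++ PB.
Proof.
rewrite /x /encode_instance /hdr /PB /fields -map_comp /= cats0 -!catA.
by [].
Qed.

Lemma size_hdr : size hdr = m + a + (l + (s0 + 5)).
Proof. by rewrite /hdr /fields [size _]/= !size_cat !size_encode_nat /=; lia. Qed.

Lemma size_TR : size TR = m * m. Proof. by rewrite size_allpairs -!cardE. Qed.
Lemma size_LB : size LB = m * a. Proof. by rewrite size_allpairs -!cardE. Qed.
Lemma size_EB : size EB = m. Proof. by rewrite size_map -cardE. Qed.
Lemma size_CB : size CB = m. Proof. by rewrite size_map -cardE. Qed.

Lemma size_enc : n = size hdr + (m * m + (m * a + (m + (m + size PB)))).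
Proof. by rewrite /n encodeE !size_cat size_TR size_LB size_EB size_CB. Qed.

(** Loops below [n] therefore reach all states, atoms and positions, and the codes up to [m + 1] are
    digits in base [n]. *)
Lemma n_bound : m + l + a + 5 <= n.
Proof. by rewrite size_enc size_hdr; lia. Qed.

Section Memory.
Variable M : nat -> nat.
(** Only the input part of the memory is fixed; the table above it changes during the run. *)
Hypothesis hM : forall y, y < n -> M y = nth false x y.

Lemma M_kind : M 0 = if k is Reach then 1 else 0.
Proof.
have n_gt0 : 0 < n by apply: leq_trans n_bound; rewrite addnS.
by rewrite hM // encodeE [nth _ _ _]/=; case: (k).
Qed.

Lemma M_hdr y : y < size (fields [:: m; a; l; s0]) ->
  M (1 + y) = nth false (fields [:: m; a; l; s0]) y.
Proof.
move=> lt; rewrite hM; last by rewrite size_enc [size hdr]/=; lia.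
by rewrite encodeE add1n [nth _ _ _]/= nth_cat lt.
Qed.

Lemma M_trans s t : M (size hdr + (enum_rank s * m + enum_rank t)) = trans T s t.
Proof.
have [hs ht] := (ltn_ord (enum_rank s), ltn_ord (enum_rank t)).
have lt : enum_rank s * m + enum_rank t < size TR by rewrite size_TR row_major_lt.
rewrite hM; last by rewrite size_enc -size_TR; lia.
have := @nth_allpairs _ _ _ (trans T) (enum S) (enum S) s t false
  (enum_rank s) (enum_rank t).
by rewrite -cardE encodeE nth_middle // !nth_enum_rank => ->.
Qed.

Lemma M_label s b :
  M (size hdr + m * m + (enum_rank s * a + enum_rank b)) = (b \in label T s).
Proof.
have [hs ht] := (ltn_ord (enum_rank s), ltn_ord (enum_rank b)).
have lt : enum_rank s * a + enum_rank b < size LB by rewrite size_LB row_major_lt.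
rewrite hM; last by rewrite size_enc -size_LB; lia.
have := @nth_allpairs _ _ _ (fun s b => b \in label T s) (enum S) (enum AP) s b
  false (enum_rank s) (enum_rank b).
by rewrite -!cardE encodeE catA -size_TR -size_cat nth_middle // !nth_enum_rank => ->.
Qed.

Lemma M_E s : M (size hdr + m * m + m * a + enum_rank s) = (s \in E).
Proof.
have hs : enum_rank s < m := ltn_ord _.
rewrite hM; last by rewrite size_enc; lia.
rewrite encodeE 2!catA -size_TR -size_LB -!size_cat nth_middle ?size_EB //.
by rewrite nth_enum_rank_map.
Qed.

Lemma M_C s : M (size hdr + m * m + m * a + m + enum_rank s) = (s \in C).
Proof.
have hs : enum_rank s < m := ltn_ord _.
rewrite hM; last by rewrite size_enc; lia.
have -> : size hdr + m * m + m * a + m = size (((hdr ++ TR) ++ LB) ++ EB).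
  by rewrite !size_cat size_TR size_LB size_EB.
by rewrite encodeE 3!catA nth_middle ?size_CB // nth_enum_rank_map.
Qed.

Lemma M_pi y : y < size PB ->
  M (size hdr + m * m + m * a + m + m + y) = nth false PB y.
Proof.
move=> lt; rewrite hM; last by rewrite size_enc; lia.
have -> : size hdr + m * m + m * a + m + m =
    size ((((hdr ++ TR) ++ LB) ++ EB) ++ CB).
  by rewrite !size_cat size_TR size_LB size_EB size_CB.
by rewrite encodeE 4!catA -[PB in LHS]cats0 nth_middle.
Qed.

(** * Meaning of the expressions of the program *)

Let v := [seq label T s | s <- pi].
Notation cell := (cell T C v).
Notation den := (den n M).
Notation holds := (holds n M).
Implicit Types (V : nat -> nat) (e : exp).

Lemma den_header V i : i < 4 ->
  den V (EField (ECst 1) (ECst i)) (nth 0 [:: m; a; l; s0] i).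
Proof.
move=> i4; apply: (den_field (p := 1)) => //; last exact: M_hdr.
by rewrite size_enc [size hdr]/= addSn ltnW // ltnS leq_addr.
Qed.

Lemma den_states V : den V e_states m. Proof. exact: (@den_header V 0). Qed.
Lemma den_atoms V : den V e_atoms a. Proof. exact: (@den_header V 1). Qed.
Lemma den_length V : den V e_length l. Proof. exact: (@den_header V 2). Qed.
Lemma den_init V : den V e_init s0. Proof. exact: (@den_header V 3). Qed.

Lemma m_le_n : m <= n. Proof. by have := n_bound; lia. Qed.

Lemma den_trans_base V : den V e_trans_base (size hdr).
Proof.
rewrite size_hdr; apply: den_add (den_add _ _) (den_add _ (den_add _ _)).
- exact: den_states.
- exact: den_atoms.
- exact: den_length.
- exact: den_init.
- exact: den_cst.
Qed.

Lemma den_label_base V : den V e_label_base (size hdr + m * m).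
Proof.
exact: den_add (@den_trans_base V) (den_mul (@den_states V) (@den_states V) m_le_n).
Qed.

Lemma den_E_base V : den V e_E_base (size hdr + m * m + m * a).
Proof.
exact: den_add (@den_label_base V) (den_mul (@den_states V) (@den_atoms V) m_le_n).
Qed.

Lemma den_C_base V : den V e_C_base (size hdr + m * m + m * a + m).
Proof. by apply: den_add (@den_E_base V) (@den_states V). Qed.

Lemma den_pi_base V : den V e_pi_base (size hdr + m * m + m * a + m + m).
Proof. by apply: den_add (@den_C_base V) (@den_states V). Qed.

Lemma holds_bool V e (b : bool) : den V e b -> holds V e b.
Proof. by move=> h; exists (nat_of_bool b) => //; case: b h. Qed.

Lemma holds_trans V e1 e2 s t :
  den V e1 (rk (Some s)) -> den V e2 (rk (Some t)) ->
  holds V (e_trans e1 e2) (trans T s t).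
Proof.
move=> h1 h2; apply: holds_bool; rewrite -M_trans; apply: den_get.
apply: den_add (@den_trans_base V) (den_add (den_mul h1 (@den_states V) _) h2).
exact: leq_trans (rk_le _) m_le_n.
Qed.

Lemma den_label V e1 e2 s (b : AP) :
  den V e1 (rk (Some s)) -> den V e2 (enum_rank b) ->
  den V (e_label e1 e2) (b \in label T s).
Proof.
move=> h1 h2; rewrite -M_label; apply: den_get.
apply: den_add (@den_label_base V) (den_add (den_mul h1 (@den_atoms V) _) h2).
exact: leq_trans (rk_le _) m_le_n.
Qed.

Lemma holds_inE V e s : den V e (rk (Some s)) -> holds V (e_inE e) (s \in E).
Proof.
move=> h; apply: holds_bool; rewrite -M_E; apply: den_get.
exact: den_add (@den_E_base V) h.
Qed.

Lemma holds_inC V e s : den V e (rk (Some s)) -> holds V (e_inC e) (s \in C).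
Proof.
move=> h; apply: holds_bool; rewrite -M_C; apply: den_get.
exact: den_add (@den_C_base V) h.
Qed.

Lemma den_pi V e i : den V e i -> i < l ->
  den V (e_pi e) (rk (Some (nth (init T) pi i))).
Proof.
move=> h il.
have -> : rk (Some (nth (init T) pi i)) =
    nth 0 [seq nat_of_ord (enum_rank s) | s <- pi] i.
  by rewrite (nth_map (init T)).
apply: den_field (@den_pi_base V) h _ _ M_pi; first by rewrite size_map.
by rewrite size_enc !addnA leq_addl.
Qed.

(** The arguments are evaluated under the binder of variable 4, hence the hypotheses for every [j];
    later lemmas treat their own bound variables in the same way. *)
Lemma den_mismatch V e1 e2 i t :
  (forall j, den (upd V 4 j) e1 i) -> (forall j, den (upd V 4 j) e2 (rk (Some t))) ->
  i < l -> den V (e_mismatch e1 e2) (nth finset.set0 v i != label T t).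
Proof.
move=> h1 h2 il; apply: den_not2.
set s := nth (init T) pi i; have -> : nth finset.set0 v i = label T s.
  by rewrite (nth_map (init T)).
pose P j := j < a /\ exists2 b : AP, enum_rank b = j :> nat &
  (b \in label T s) != (b \in label T t).
apply: (@holds_iff _ _ _ _ (exists2 j, j < n & P j)).
  apply: holds_sum => // j jn; apply: holds_guard.
    by apply: holds_lt; [exact: den_atoms|exact: (@den_var _ _ _ 4)].
  move=> ja; have [b eb] : exists b : AP, enum_rank b = j :> nat.
    by exists (enum_val (Ordinal ja)); rewrite enum_valK.
  have hv : den (upd V 4 j) (EVar 4) (enum_rank b).
    by rewrite eb; exact: (@den_var _ _ _ 4).
  apply: holds_iff (holds_not (holds_eq (den_label (den_pi (h1 j) il) hv)
    (den_label (h2 j) hv))) _.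
  split=> [h|[b' eb' ne] e].
    by exists b => //; apply/eqP => e; apply: h; rewrite e.
  have bb : b' = b by apply/enum_rank_inj/val_inj; rewrite /= eb' eb.
  by move: ne; rewrite bb; move: e; do 2!case: (_ \in _).
split=> [[j _ [_ [b _ ne]]]|ne].
  by apply: contraNneq ne => ->.
have [b hb] : exists b, (b \in label T s) != (b \in label T t).
  apply: contrapT => h; case/eqP: ne; apply/finset.setP => b.
  by apply/eqP; apply: contrapT => hb; apply: h; exists b; exact/negP.
exists (enum_rank b); last by split; [exact: ltn_ord|exists b].
have := ltn_ord (enum_rank b); have := n_bound; rewrite -/a; lia.
Qed.

Definition idx (w i s : nat) := n * (n * w + i) + s.

Definition cell_ok w i o : Prop := M (n + idx w i (rk o)) != 0 <-> cell w i o.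

Lemma den_address V e1 e2 e3 w i s :
  den V e1 w -> den V e2 i -> den V e3 s ->
  den V (e_address e1 e2 e3) (n + idx w i s).
Proof.
move=> h1 h2 h3; apply: den_add (@den_len _ _ _) (den_add _ h3).
have dn := @den_len n M V.
by apply: den_mul dn (den_add (den_mul dn h1 _) h2) _.
Qed.

Lemma holds_cell V e1 e2 e3 w i o :
  den V e1 w -> den V e2 i -> den V e3 (rk o) -> cell_ok w i o ->
  holds V (e_cell e1 e2 e3) (cell w i o).
Proof.
move=> h1 h2 h3 ok; apply: holds_iff ok; apply: holds_nonzero.
exact/den_get/den_address.
Qed.

Lemma holds_edge V e1 e2 o t :
  den V e1 (rk o) -> den V e2 (rk (Some t)) ->
  holds V (e_edge e1 e2) (edge T o t).
Proof.
move=> h1 h2.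
have hs : holds V (EEq e2 e_init) (t == init T).
  apply: holds_iff (holds_eq h2 (@den_init V)) _.
  by split=> [/val_inj/enum_rank_inj ->|/eqP ->].
have hlt := holds_lt (@den_states V) h1; have heq := holds_eq h1 (@den_states V).
case: o h1 hlt heq => [s|] h1 hlt heq.
  apply: holds_iff (holds_add (holds_guard hlt (fun=> holds_trans h1 h2))
    (holds_guard heq (fun=> hs))) _.
  have := rk_some s; split=> [[[]|[e _]]|h] //; last by left.
  by have := rk_some s; rewrite e ltnn.
apply: holds_iff (holds_add (holds_guard hlt (Q := False) _)
  (holds_guard heq (fun=> hs))) _; first by rewrite ltnn.
by split=> [[[]|[]]|] //; right.
Qed.

Lemma holds_pred V e1 e2 e3 w i t :
  (forall j, den (upd V 3 j) e1 w) -> (forall j, den (upd V 3 j) e2 i) ->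
  (forall j, den (upd V 3 j) e3 (rk (Some t))) -> (forall o, cell_ok w i o) ->
  holds V (e_pred e1 e2 e3) (exists2 o, edge T o t & cell w i o).
Proof.
move=> h1 h2 h3 ok.
pose P j := j < m + 1 /\ exists2 o, rk o = j & edge T o t /\ cell w i o.
apply: (@holds_iff _ _ _ _ (exists2 j, j < n & P j)).
  apply: holds_sum => // j jn; have hj := @den_var n M (upd V 3 j) 3 isT.
  apply: holds_guard (holds_lt (den_add (@den_states _) (@den_cst _ _ _ _)) hj) _.
  rewrite addn1 ltnS => /rk_surj[o eo].
  have hj' : den (upd V 3 j) (EVar 3) (rk o) by rewrite eo; exact: hj.
  apply: holds_iff (holds_guard (holds_edge hj' (h3 j))
    (fun=> holds_cell (h1 j) (h2 j) hj' (ok o))) _.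
  by split=> [h|[o' eo' h]]; [exists o|rewrite -(rk_inj (etrans eo' (esym eo)))].
split=> [[j _ [_ [o _ [h h']]]]|[o h h']]; first by exists o.
have := rk_le o; have := n_bound => h4 h5.
by exists (rk o); [lia|split; [lia|exists o]].
Qed.

(** Insertion reads weight [w - 1] at the same [i], while deletion and substitution read [i - 1] at
    weight at most [w]; the two hypotheses on cells provide these. *)
Lemma holds_new V w i o :
  V 0 = w -> V 1 = i -> V 2 = rk o -> i <= l ->
  (forall w' o', w' < w -> cell_ok w' i o') ->
  (forall w' i' o', w' <= w -> i' < i -> cell_ok w' i' o') ->
  holds V (e_new (EVar 0) (EVar 1) (EVar 2)) (cell w i o).
Proof.
move=> Vw Vi Vs il okw oki.
have h0 y j : 2 < y -> den (upd V y j) (EVar 0) w.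
  by case: y => [|[|[|y]]] // _; rewrite -Vw; exact: (@den_var _ _ _ 0).
have h1 y j : 2 < y -> den (upd V y j) (EVar 1) i.
  by case: y => [|[|[|y]]] // _; rewrite -Vi; exact: (@den_var _ _ _ 1).
have h2 y j : 2 < y -> den (upd V y j) (EVar 2) (rk o).
  by case: y => [|[|[|y]]] // _; rewrite -Vs; exact: (@den_var _ _ _ 2).
have d0 : den V (EVar 0) w by rewrite -Vw; exact: den_var.
have d1 : den V (EVar 1) i by rewrite -Vi; exact: den_var.
have d2 : den V (EVar 2) (rk o) by rewrite -Vs; exact: den_var.
have p0 y j : 2 < y -> den (upd V y j) (ESub (EVar 0) (ECst 1)) (w - 1).
  by move=> y2; apply: den_sub (h0 _ _ y2) (@den_cst _ _ _ _).
have p1 y j : 2 < y -> den (upd V y j) (ESub (EVar 1) (ECst 1)) (i - 1).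
  by move=> y2; apply: den_sub (h1 _ _ y2) (@den_cst _ _ _ _).
have hstart := holds_guard (holds_eq d0 (@den_cst _ _ _ 0))
  (fun=> holds_guard (holds_eq d1 (@den_cst _ _ _ 0))
  (fun=> holds_eq d2 (@den_states V))).
have hdelete : holds V (EGuard (EVar 0) (EGuard (EVar 1)
    (e_cell (ESub (EVar 0) (ECst 1)) (ESub (EVar 1) (ECst 1)) (EVar 2))))
    (w != 0 /\ (i != 0 /\ cell (w - 1) (i - 1) o)).
  apply: holds_guard (holds_nonzero d0) _ => w0.
  apply: holds_guard (holds_nonzero d1) _ => i0.
  apply: holds_cell => //; try exact: den_sub d0 (@den_cst _ _ _ _).
    exact: den_sub d1 (@den_cst _ _ _ _).
  by apply: oki; lia.
have hlt := holds_lt (@den_states V) d2.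
have cE o' : cell w i o' <-> cell_spec T C v w i o'.
  by apply: cellP; rewrite size_map.
(* The empty path has code [m], which fails the range test; only the start and deletion remain. *)
case: o => [t|] in Vs h2 d2 hstart hdelete hlt *; last first.
  apply: holds_iff (holds_add (holds_add hstart hdelete)
    (holds_guard hlt (Q := False) _)) _; first by rewrite ltnn.
  rewrite cE; split.
    case=> [[[-> [-> _]]|[w0 [i0 h]]]|[]//]; first exact: CellStart.
    by apply: (CellDelete (w' := w - 1) (i' := i - 1)) => //; lia.
  case=> [-> ->|w' i' -> -> h|w' o' u _ //|w' i' o' u _ _ //]; first by left; left.
  by left; right; rewrite !subn1.
set c := nth finset.set0 v (i - 1) != label T t.
have hinsert : holds V (EGuard (EVar 0) (e_pred (ESub (EVar 0) (ECst 1)) (EVar 1) (EVar 2)))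
    (w != 0 /\ exists2 o', edge T o' t & cell (w - 1) i o').
  apply: holds_guard (holds_nonzero d0) _ => w0.
  apply: holds_pred => [j|j|j|o']; [exact: p0|exact: h1|exact: h2|].
  by apply: okw; lia.
have hsubst : holds V (EGuard (EVar 1) (EGuard
      (ESub (EAdd (EVar 0) (ECst 1)) (e_mismatch (ESub (EVar 1) (ECst 1)) (EVar 2)))
      (e_pred (ESub (EVar 0) (e_mismatch (ESub (EVar 1) (ECst 1)) (EVar 2)))
        (ESub (EVar 1) (ECst 1)) (EVar 2))))
    (i != 0 /\ (c < w + 1 /\ exists2 o', edge T o' t & cell (w - c) (i - 1) o')).
  apply: holds_guard (holds_nonzero d1) _ => i0.
  have il' : i - 1 < l by lia.
  (* Needed both at [V] and under the binder of variable 3 in [e_pred]. *)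
  have hc V' : (forall x, x < 3 -> V' x = V x) ->
      den V' (e_mismatch (ESub (EVar 1) (ECst 1)) (EVar 2)) c.
    move=> hV; apply: den_mismatch => // j.
      by rewrite -Vi -hV //; exact: den_sub (@den_var _ _ _ 1 isT) (@den_cst _ _ _ _).
    by rewrite -Vs -hV //; exact: (@den_var _ _ _ 2).
  apply: holds_guard.
    by apply: holds_lt (den_add d0 (@den_cst _ _ _ _)) (hc _ _).
  move=> cw; apply: holds_pred => [j|j|j|o'].
  - apply: den_sub (h0 _ _ _) (hc _ _) => // y y3.
    by rewrite /upd; case: eqP y3 => // ->.
  - exact: p1.
  - exact: h2.
  - by apply: oki; lia.
apply: holds_iff (holds_add (holds_add hstart hdelete)
  (holds_guard hlt (fun=> holds_guard (holds_not (holds_inC d2))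
    (fun=> holds_add hinsert hsubst)))) _.
rewrite cE; split.
  case=> [[[_ [_ e]]|[w0 [i0 h]]]|[_ [tC [[w0 [o' h1' h2']]|[i0 [cw [o' h1' h2']]]]]]].
  - by have := rk_some t; rewrite e ltnn.
  - by apply: (CellDelete (w' := w - 1) (i' := i - 1)) => //; lia.
  - apply: (CellInsert (w' := w - 1) (o' := o') (t := t)) => //; first lia.
    exact/negP.
  - by apply: (CellSubst (w' := w - c) (i' := i - 1) (o' := o') (t := t)) => //; lia.
case=> [_ _ //|w' i' ew ei h|w' o' u ew [eu] uC h h'|w' i' o' u ew ei [eu] uC h h'].
- by left; right; rewrite ew ei !subn1.
- right; split; first exact: rk_some.
  split; first by apply/negP; rewrite eu.
  by left; split; [rewrite ew|exists o'; rewrite ?eu // ew subn1].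
- right; split; first exact: rk_some.
  split; first by apply/negP; rewrite eu.
  right; rewrite ei; split=> //.
  have ec : c = (nth finset.set0 v i' != label T u) by rewrite /c ei subn1 eu.
  rewrite -ec in ew; split; first by lia.
  by exists o'; rewrite ?eu // subn1 ew addnK.
Qed.

Definition table_ok : Prop :=
  forall w i o, w < n -> i <= l -> cell_ok w i o.

Lemma holds_terminal V e t :
  (forall j, den (upd V 5 j) e (rk (Some t))) ->
  holds V (e_terminal e) (t \in terminal T).
Proof.
move=> h; pose P j := j < m /\ exists2 u, rk (Some u) = j & trans T t u.
apply: (@holds_iff _ _ _ _ (~ exists2 j, j < n & P j)).
  apply: holds_not; apply: holds_sum => // j jn.
  have hj := @den_var n M (upd V 5 j) 5 isT.
  apply: holds_guard (holds_lt (@den_states _) hj) _ => /rk_surj_some[u eu].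
  have hj' : den (upd V 5 j) (EVar 5) (rk (Some u)) by rewrite eu; exact: hj.
  apply: holds_iff (holds_trans (h j) hj') _.
  by split=> [tu|[u' eu' tu]]; [exists u|have [<-] := rk_inj (etrans eu' (esym eu))].
rewrite inE; split=> [h'|/forallP h' [j _ [_ [u _ tu]]]].
  apply/forallP => u; apply/negP => tu; apply: h'; have := rk_some u => um.
  by exists (rk (Some u)); [exact: leq_trans um m_le_n|split=> //; exists u].
by have := h' u; rewrite tu.
Qed.

Definition ends_spec (e : exp -> exp) (A : {set S}) : Prop :=
  forall V ew w, w < n -> (forall j, den (upd V 6 j) ew w) ->
    holds V (e ew) (ends T C v w A).

Hypothesis tab : table_ok.

Lemma holds_ends f (A : {set S}) :
  (forall V t, V 6 = rk (Some t) -> holds V (f (EVar 6)) (t \in A)) ->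
  ends_spec (e_ends f) A.
Proof.
move=> hf V ew w wn hw.
pose P j := j < m /\ exists2 t, rk (Some t) = j & t \in A /\ cell w l (Some t).
apply: (@holds_iff _ _ _ _ (exists2 j, j < n & P j)).
  apply: holds_sum => // j jn; have hj := @den_var n M (upd V 6 j) 6 isT.
  apply: holds_guard (holds_lt (@den_states _) hj) _ => /rk_surj_some[t et].
  have hj' : den (upd V 6 j) (EVar 6) (rk (Some t)) by rewrite et; exact: hj.
  apply: holds_iff (holds_guard (hf _ _ (esym et))
    (fun=> holds_cell (hw j) (@den_length _) hj' (tab _ wn (leqnn l)))) _.
  by split=> [h|[u eu h]]; [exists t|have [<-] := rk_inj (etrans eu (esym et))].
rewrite /ends size_map; split=> [[j _ [_ [t _ [tA h]]]]|[t tA h]]; first by exists t.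
have um := rk_some t.
by exists (rk (Some t)); [exact: leq_trans um m_le_n|split=> //; exists t].
Qed.

Lemma ends_E : ends_spec e_ends_E E.
Proof.
apply: holds_ends => V t Vt; apply: holds_inE; rewrite -Vt; exact: den_var.
Qed.

Lemma ends_N : ends_spec e_ends_N (terminal T :\: E).
Proof.
apply: holds_ends => V t Vt.
have h : den V (EVar 6) (rk (Some t)) by rewrite -Vt; exact: den_var.
apply: holds_iff (holds_guard (holds_not (holds_inE h))
  (fun=> holds_terminal (t := t) _)) _.
  by move=> _ j; rewrite -Vt; exact: (@den_var _ _ _ 6).
by rewrite finset.in_setD; split=> [[/negP-> ->]|/andP[/negP]].
Qed.

Lemma holds_wins eX eY X Y V : ends_spec eX X -> ends_spec eY Y ->
  holds V (e_wins eX eY) (wins T C v X Y n).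
Proof.
move=> hX hY.
(* The bound [w' < n] of the sum loses nothing, as [w' <= w < n]. *)
pose Q w := exists2 w', w' < n & w' < w + 1 /\ ends T C v w' Y.
apply: (@holds_iff _ _ _ _ (exists2 w, w < n & ends T C v w X /\ ~ Q w)).
  apply: holds_sum => // w wn; apply: holds_guard => [|_].
    by apply: hX => // j; exact: (@den_var _ _ _ 7).
  apply: holds_not; apply: holds_sum => // w' wn'.
  apply: holds_guard => [|_].
    apply: holds_lt (den_add (@den_var _ _ _ 7 isT) (@den_cst _ _ _ _)) _.
    exact: (@den_var _ _ _ 8).
  by apply: hY => // j; exact: (@den_var _ _ _ 8).
split=> [[w wn [h nQ]]|[w [wn h nY]]]; exists w => //.
  split=> // w' ww' h'; apply: nQ; exists w'; first exact: leq_ltn_trans wn.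
  by rewrite addn1 ltnS.
by split=> // -[w' _]; rewrite addn1 ltnS => -[ww']; exact: nY.
Qed.

Lemma holds_none V : holds V e_none (no_end T C v (terminal T :\: E) E n).
Proof.
pose P w := ends T C v w (terminal T :\: E) \/ ends T C v w E.
apply: (@holds_iff _ _ _ _ (~ exists2 w, w < n & P w)).
  apply: holds_not; apply: holds_sum => // w wn.
  by apply: holds_add; [apply: ends_N|apply: ends_E] => // j;
    exact: (@den_var _ _ _ 7).
split=> [h w wn|h [w wn]]; last by have [h1 h2] := h w wn; case.
by split=> h'; apply: h; exists w => //; [left|right].
Qed.

Lemma holds_alive V :
  holds V e_alive (exists p, safe T C p /\ size p = m.+1).
Proof.
pose P j := j < m /\ exists2 t, rk (Some t) = j & cell (m + 1) 0 (Some t).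
have mn : m + 1 < n by have := n_bound; lia.
apply: (@holds_iff _ _ _ _ (exists2 j, j < n & P j)).
  apply: holds_sum => // j jn; have hj := @den_var n M (upd V 6 j) 6 isT.
  apply: holds_guard (holds_lt (@den_states _) hj) _ => /rk_surj_some[t et].
  have hj' : den (upd V 6 j) (EVar 6) (rk (Some t)) by rewrite et; exact: hj.
  apply: holds_iff (holds_cell (den_add (@den_states _) (@den_cst _ _ _ 1))
    (@den_cst _ _ _ 0) hj' (tab _ mn (leq0n l))) _.
  by split=> [h|[u eu h]]; [exists t|have [<-] := rk_inj (etrans eu (esym et))].
split=> [[j _ [_ [t _ /cell_start[p [sp _ sz]]]]]|[p [sp sz]]].
  by exists p; rewrite sz addn1.
case: p sp sz => // s p sp sz; have um := rk_some (last s p).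
exists (rk (Some (last s p))); first exact: leq_trans um m_le_n.
split=> //; exists (last s p) => //; apply/cell_start.
by exists (s :: p); rewrite addn1.
Qed.

Hypothesis subE : E \subset terminal T.

Lemma holds_result V :
  holds V result_exp
    (counterfactual_cause T (dLev_path T) C (satisfies k E) (Fin pi)).
Proof.
have nl : size v + #|S| < n by rewrite size_map; have := n_bound; rewrite -/l -/m; lia.
have EN : E :|: (terminal T :\: E) = terminal T.
  apply/finset.setP => t; rewrite finset.in_setU finset.in_setD.
  by case tE: (t \in E) => //=; rewrite (fintype.subsetP subE).
have NE : terminal T :\: E :|: E = terminal T by rewrite finset.setUC.
have dEN : [disjoint E & terminal T :\: E].
  rewrite -finset.setI_eq0; apply/eqP/finset.setP => t.
  rewrite finset.in_setI finset.in_setD finset.in_set0.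
  by case: (t \in E).
have dNE : [disjoint terminal T :\: E & E] by rewrite disjoint_sym.
have hres : holds V result_exp
    ((M 0 != 0 /\ (wins T C v (terminal T :\: E) E n \/
       no_end T C v (terminal T :\: E) E n /\ exists p, safe T C p /\ size p = m.+1))
     \/ (~ (M 0 != 0) /\ wins T C v E (terminal T :\: E) n)).
  have h0 : holds V (EGet (ECst 0)) (M 0 != 0).
    exact: holds_nonzero (den_get (@den_cst _ _ _ 0)).
  apply: holds_add.
    apply: holds_guard h0 _ => _; apply: holds_add; first exact: holds_wins ends_N ends_E.
    by apply: holds_guard (@holds_none V) _ => _; exact: holds_alive.
  by apply: holds_guard (holds_not h0) _ => _; exact: holds_wins ends_E ends_N.
apply: holds_iff hres _; rewrite M_kind; case: (k) => /=.
  have PhiP p t : maximal_path T (Fin p) -> olast p = Some t ->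
      t \in terminal T -> eventually E (Fin p) <-> t \in E.
    by move=> mp po _; exact: (eventually_fin subE mp po).
  rewrite (counterfactual_causeP C NE dNE nl erefl PhiP) -infinite_safeP.
  split; first case=> [[_ [h|[h1 h2]]]|[] //]; first by left.
    by right; split=> // f [fp _] _; apply: eventually_inf fp.
  by case=> [h|[h1 h2 _]]; left; split=> //; [left|right].
have PhiP p t : maximal_path T (Fin p) -> olast p = Some t ->
    t \in terminal T -> always (~: E) (Fin p) <-> t \in terminal T :\: E.
  move=> mp po tt; rewrite always_notE (eventually_fin subE mp po) finset.in_setD tt andbT.
  by split=> /negP.
rewrite (counterfactual_causeP C EN dEN nl erefl PhiP).
split=> [[[]//|[_ h]]|[h|[_ [f [mf af]] h]]]; [by left|by right; split|].
(* For [Avoid], an infinite candidate would satisfy [Phi], so the second alternative cannot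
   occur. *)
exfalso; apply: (h f mf af); rewrite always_notE.
by case: mf => fp _; exact: eventually_inf fp.
Qed.

End Memory.

(** * Filling the table *)

Lemma m_lt_n : m < n. Proof. by have := n_bound; rewrite -/m; lia. Qed.
Lemma l_lt_n : l < n. Proof. by have := n_bound; rewrite -/l; lia. Qed.

(** With lower digits below [n], [idx] orders triples lexicographically; injectivity follows from
    this. *)
Lemma idx_ltr w i i' s s' : i < i' -> s < n -> idx w i s < idx w i' s'.
Proof.
move=> ii sn; apply: (@leq_trans (idx w i.+1 0)).
  by rewrite /idx addnS mulnS addn0 addnC ltn_add2r.
by rewrite /idx addn0 (leq_trans _ (leq_addr _ _)) // leq_mul2l leq_add2l ii orbT.
Qed.

Lemma idx_ltl w w' i i' s s' : w < w' -> i < n -> s < n ->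
  idx w i s < idx w' i' s'.
Proof.
move=> ww im sn; apply: (@leq_trans (idx w n 0)); first exact: idx_ltr.
rewrite /idx -mulnSr addn0 (leq_trans _ (leq_addr _ _)) // leq_mul2l.
by rewrite (leq_trans _ (leq_addr _ _)) ?orbT // leq_mul2l ww orbT.
Qed.

Lemma idx_inj w w' i i' s s' :
  i < n -> i' < n -> s < n -> s' < n -> idx w i s = idx w' i' s' ->
  [/\ w = w', i = i' & s = s'].
Proof.
move=> im im' sm sm' e.
have ew : w = w'.
  by case: (ltngtP w w') => // h; [have := idx_ltl i' s' h im sm|
    have := idx_ltl i s h im' sm']; rewrite e ltnn.
subst w'; have ei : i = i'.
  by case: (ltngtP i i') => // h; [have := idx_ltr w s' h sm|
    have := idx_ltr w s h sm']; rewrite e ltnn.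
by subst i'; split=> //; apply/eqP; move/eqP: e; rewrite eqn_add2l.
Qed.

(** The input is intact and the cells before [q], the next one to fill, are correct. *)
Definition table_inv (q : nat) (M : nat -> nat) : Prop :=
  (forall y, y < n -> M y = nth false x y) /\
  forall w i o, w < n -> i <= l -> idx w i (rk o) < q -> cell_ok M w i o.

(** The write goes above the input and, by injectivity of [idx], spares the earlier cells. The new
    cell is correct by [holds_new], since the cells it reads have smaller indices. *)
Lemma table_step V M w i s :
  V 0 = w -> V 1 = i -> V 2 = s -> w < n -> i < n -> s < n ->
  table_inv (idx w i s) M ->
  table_inv (idx w i s.+1) (exec n V M
    (CPut (e_address (EVar 0) (EVar 1) (EVar 2))
          (e_new (EVar 0) (EVar 1) (EVar 2)))).
Proof.
move=> V0 V1 V2 wn im sm [hM tab]; rewrite /exec.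
have -> : eval n V M (e_address (EVar 0) (EVar 1) (EVar 2)) = n + idx w i s.
  apply: den_eval; rewrite -V0 -V1 -V2.
  by apply: den_address; exact: den_var.
set val := eval n V M _; split=> [y yn|w' i' o wn' il'].
  by rewrite /upd ltn_eqF ?hM // (leq_trans yn) // leq_addr.
have i'n : i' < n := leq_ltn_trans il' l_lt_n.
have o_n := leq_ltn_trans (rk_le o) m_lt_n.
rewrite /idx addnS ltnS -/(idx _ _ _) -/(idx _ _ _) leq_eqVlt /cell_ok /upd eqn_add2l.
case: eqP => [e _|_ /= lt]; last exact: tab.
have [ew ei es] := idx_inj i'n im o_n sm e.
rewrite ew ei in il' *.
have [b hb <-] : holds n M V (e_new (EVar 0) (EVar 1) (EVar 2))
    (cell T C [seq label T t | t <- pi] w i o).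
  apply: (holds_new hM) => //; first by rewrite es.
    move=> w2 o2 lt; apply: tab => //; first exact: ltn_trans lt wn.
    by apply: idx_ltl => //; exact: leq_ltn_trans (rk_le _) m_lt_n.
  move=> w2 i2 o2 le lt; have i2n : i2 < n by exact: ltn_trans lt im.
  have r2n := leq_ltn_trans (rk_le o2) m_lt_n.
  apply: tab; first exact: leq_ltn_trans le wn.
    exact: leq_trans (ltnW lt) il'.
  move: le; rewrite leq_eqVlt => /orP[/eqP ->|le]; [exact: idx_ltr|exact: idx_ltl].
by rewrite /val (den_eval hb).
Qed.

Lemma table_correct :
  let M := exec n (fun=> 0) (fun y => nth false x y) table_cmd in
  (forall y, y < n -> M y = nth false x y) /\ table_ok M.
Proof.
move=> M.
(* Carrying in base [n]: the invariant at the end of an inner loop is the one at the start of the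
   next round of the outer loop. *)
have idxS w i : idx w i n = idx w i.+1 0.
  by rewrite /idx; move: (n) => N; rewrite addn0 addnS mulnSr.
have idxSS w : idx w n 0 = idx w.+1 0 0.
  by rewrite /idx; move: (n) => N; rewrite !addn0 -mulnSr.
have [hM tab] : table_inv (idx n 0 0) M.
  apply: (exec_for (J := fun w => table_inv (idx w 0 0))); last first.
    by split=> // w i o _ _; rewrite [idx 0 0 0]/idx !addn0 !muln0 ltn0.
  move=> w M1 wn h1; rewrite -idxSS.
  apply: (exec_for (J := fun i => table_inv (idx w i 0))) h1.
  move=> i M2 im h2; rewrite -idxS.
  apply: (exec_for (J := fun s => table_inv (idx w i s))) h2.
  by move=> s M3 sm h3; apply: table_step.
split; first exact: hM.
move=> w i o wn il; apply: (tab w i o wn il); apply: idx_ltl => //.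
  exact: leq_ltn_trans il l_lt_n.
exact: leq_ltn_trans (rk_le _) m_lt_n.
Qed.

Lemma decides_encoded :
  E \subset terminal T ->
  decides_within (compile table_cmd result_exp)
    (compile_cost table_cmd result_exp) x
    (counterfactual_cause T (dLev_path T) C (satisfies k E) (Fin pi)).
Proof.
move=> subE; have [hM tab] := table_correct.
have [b hb bP] := holds_result hM tab subE (fun=> 0).
exists (b != 0); split=> //; rewrite -(den_eval hb); exact: compile_correct.
Qed.

End Encoding.

Theorem theorem4 :
  exists (P : ram) (q : {poly nat}),
    forall (AP S : finType) (T : transition_system AP S) (E C : {set S})
           (k : kind) (pi : seq S),
      E \subset terminal T ->
      [disjoint C & E] ->
      maximal_path T (Fin pi) ->
      eventually C (Fin pi) ->
      satisfies k E (Fin pi) ->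
      decides_within P q (encode_instance T E C k pi)
        (counterfactual_cause T (dLev_path T) C (satisfies k E) (Fin pi)).
Proof.
exists (compile table_cmd result_exp), (compile_cost table_cmd result_exp).
by move=> AP S T E C k pi subE _ _ _ _; exact: decides_encoded.
Qed.
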